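(* Let $H$ be the Hamiltonian with the preferred-orientation coupling at every vertex of the equilateral metric graph formed by the vertices and edges of the regular octahedron, all edges having length $1$. Consider the numbers $k>0$ such that $k^2$ is an eigenvalue of $H$, each counted with the multiplicity of $k^2$ as an eigenvalue of $H$. Then: (1) every $k=2\pi n>0$, $n\in\mathbb Z$, is such a number, with multiplicity eight; (2) every $k=\pm\frac{2}{3}\pi+2\pi n>0$, $n\in\mathbb Z$ (either sign), is such a number, with multiplicity two; (3) all the other such $k$ are situated in the intervals $$\left[\pi+2\pi n-\frac{\sqrt{10}}{k}+\mathcal O\!\left(\frac1{k^2}\right),\;\pi+2\pi n+\frac{\sqrt{10}}{k}+\mathcal O\!\left(\frac1{k^2}\right)\right],$$ $$\left[\frac{\pi}{2}+\pi n-\frac{5}{k^2}+\mathcal O\!\left(\frac1{k^4}\right),\;\frac{\pi}{2}+\pi n+\frac{5}{k^2}+\mathcal O\!\left(\frac1{k^4}\right)\right],\qquad n\in\mathbb Z,$$ as $k\to\infty$. That is, there exist constants $C,K>0$ such that for every $k\ge K$ for which $k^2$ is an eigenvalue of $H$ and which is not of the form $2\pi n$ or $\pm\frac23\pi+2\pi n$ with $n\in\mathbb Z$, there is $n\in\mathbb Z$ such that $$|k-\pi-2\pi n|\le\frac{\sqrt{10}}{k}+\frac{C}{k^2}\qquad\text{or}\qquad \left|k-\frac{\pi}{2}-\pi n\right|\le\frac{5}{k^2}+\frac{C}{k^4}.$$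
   Context: Graph: the metric graph whose vertices and edges are those of the given Platonic solid in $\mathbb R^3$; each of its $N$ edges is identified with the interval $(0,1)$ (the choice of direction of the identification is immaterial). Operator: $H$ acts on $\bigoplus_{e=1}^N L^2((0,1))$ as $f_e\mapsto -f_e''$ on every edge. Its domain consists of all functions in $\bigoplus_{e=1}^N W^{2,2}((0,1))$ satisfying, at every vertex $v$, the coupling condition $$(U_v-I)\Psi_v+i(U_v+I)\Psi_v'=0,$$ where $\Psi_v\in\mathbb C^d$ is the vector of boundary values at $v$ of the functions on the $d$ edges meeting at $v$ ($d$ is the degree of $v$), and $\Psi_v'\in\mathbb C^d$ is the vector of the corresponding outgoing derivatives, i.e. $f'(0)$ if $v$ corresponds to the endpoint $x=0$ of the edge, and $-f'(1)$ if $v$ corresponds to the endpoint $x=1$. Preferred-orientation coupling: at every vertex the edges are numbered $1,\dots,d$ consecutively in the clockwise cyclic order as seen from the exterior of the solid, and $U_v$ is the $d\times d$ cyclic permutation matrix with $(U_v)_{m,m+1}=1$ for $m=1,\dots,d-1$, $(U_v)_{d,1}=1$, and all other entries $0$. Explicitly, with cyclic indices, the coupling condition reads $\psi_{m+1}-\psi_m+i(\psi'_{m+1}+\psi'_m)=0$ for $m=1,\dots,d$. The operator $H$ is self-adjoint with purely discrete spectrum. Only positive eigenvalues $k^2$ with $k>0$ are considered. *)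

(* Defs.v *)
From HB Require Import structures.
From mathcomp Require Import all_boot all_order all_algebra.
From mathcomp Require Import complex.
From mathcomp Require Import all_classical all_reals all_analysis.

Set Implicit Arguments.
Unset Strict Implicit.
Unset Printing Implicit Defensive.

Import Order.TTheory GRing.Theory Num.Theory.
Import numFieldNormedType.Exports.

Local Open Scope ring_scope.

Section Sobolev.
Variable R : realType.

Definition L2_real (g : R -> R) : Prop :=
  g \_ (`]0, 1[%classic : set R) \in Lfun (@lebesgue_measure R) 2%:E.

Definition L2 (g : R -> R[i]) : Prop :=
  L2_real (fun x => complex.Re (g x)) /\ L2_real (fun x => complex.Im (g x)).

Definition cint (g : R -> R[i]) (x : R) : R[i] :=
  Complex (\int[@lebesgue_measure R]_(t in `[0, x]) complex.Re (g t))
          (\int[@lebesgue_measure R]_(t in `[0, x]) complex.Im (g t)).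

(* f is the absolutely continuous representative on [0, 1] of an element of
   W^{1,2}((0,1)) whose weak derivative is the class of g. *)
Definition W12 (f g : R -> R[i]) : Prop :=
  L2 g /\ forall x, 0 <= x <= 1 -> f x = f 0 + cint g x.

(* f is the C^1 representative on [0, 1] of an element of W^{2,2}((0,1)), f1 is
   its classical derivative on [0, 1] (one-sided at the endpoints) and f2
   represents its second weak derivative. *)
Definition W22 (f f1 f2 : R -> R[i]) : Prop := W12 f f1 /\ W12 f1 f2.

End Sobolev.

(* An equilateral metric graph, regular of degree d, with edges (0,1): the
   boundary points are the pairs (e, b), b = false standing for the endpoint
   x = 0 of the edge e and b = true for x = 1, and star v m is the boundary
   point at v of the m-th edge meeting at v. *)
Section QuantumGraph.
Variables (R : realType) (V E : finType) (d : nat).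
Variables (star : V -> 'I_d -> E * bool) (U : V -> 'M[R[i]]_d).

Definition boundary_value (f : E -> R -> R[i]) (p : E * bool) : R[i] :=
  if p.2 then f p.1 1 else f p.1 0.

Definition outgoing_derivative (f1 : E -> R -> R[i]) (p : E * bool) : R[i] :=
  if p.2 then - f1 p.1 1 else f1 p.1 0.

Definition coupling (f f1 : E -> R -> R[i]) (v : V) : Prop :=
  let Psi := \col_m boundary_value f (star v m) in
  let Psi' := \col_m outgoing_derivative f1 (star v m) in
  (U v - 1%:M) *m Psi + 'i%C *: ((U v + 1%:M) *m Psi') = 0.

(* Families of functions on the edges stand for elements of the direct sum of
   the L^2((0,1)), which vanish when they vanish almost everywhere. *)
Definition vanishes (f : E -> R -> R[i]) : Prop :=
  forall e, {ae @lebesgue_measure R, forall x, x \in `]0, 1[ -> f e x = 0}.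

(* The graph of the operator: f is (the C^1 representative of) an element of
   the domain, and g represents its image. *)
Definition hamiltonian (f g : E -> R -> R[i]) : Prop :=
  exists f1 f2 : E -> R -> R[i],
    [/\ forall e, W22 (f e) (f1 e) (f2 e),
        forall v, coupling f f1 v
      & vanishes (fun e x => g e x - (- f2 e x))].

Definition in_eigenspace (lambda : R[i]) (f : E -> R -> R[i]) : Prop :=
  hamiltonian f (fun e x => lambda * f e x).

Definition is_eigenvalue (lambda : R[i]) : Prop :=
  exists f, in_eigenspace lambda f /\ ~ vanishes f.

Definition has_multiplicity (lambda : R[i]) (n : nat) : Prop :=
  exists b : 'I_n -> E -> R -> R[i],
    [/\ forall j, in_eigenspace lambda (b j),
        forall c : 'I_n -> R[i],
          vanishes (fun e x => \sum_j c j * b j e x) -> forall j, c j = 0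
      & forall f, in_eigenspace lambda f ->
          exists c : 'I_n -> R[i],
            vanishes (fun e x => f e x - \sum_j c j * b j e x)].

End QuantumGraph.

(* ordS is the cyclic successor on 'I_d. *)
Definition cyclic_mx (R : realType) (d : nat) : 'M[R[i]]_d :=
  \matrix_(m, j) (j == ordS m)%:R.

(* The octahedron with vertices the unit vectors and their opposites; the
   boolean is the sign, true for minus. *)
Definition octV : finType := ('I_3 * bool)%type.

Definition oct_pos (v : octV) : 'rV[int]_3 := (-1) ^+ v.2 *: delta_mx 0 v.1.

(* Two vertices are joined unless they are equal or opposite. *)
Definition oct_adj (v w : octV) : bool := v.1 != w.1.

Definition octE : finType :=
  {A : {set octV} | [exists v, exists w, oct_adj v w && (A == [set v; w])]}.

(* For adjacent v, w, w', the turn about v that leads from w to w' is seen from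
   the exterior, that is, against the outward normal oct_pos v, as a clockwise
   one iff (v, w, w') is a negatively oriented frame. *)
Definition clockwise (v w w' : octV) : bool :=
  \det (\matrix_(i < 3) tnth [tuple oct_pos v; oct_pos w; oct_pos w'] i) < 0.

(* ends e false and ends e true are the vertices at the endpoints x = 0 and
   x = 1 of the edge e identified with (0,1). *)
Definition oct_param (ends : octE -> bool -> octV) : Prop :=
  forall e, val e = [set ends e false; ends e true].

Definition clockwise_numbering (ends : octE -> bool -> octV)
    (star : octV -> 'I_4 -> octE * bool) : Prop :=
  forall v,
    [/\ injective (star v),
        forall m, ends (star v m).1 (star v m).2 = v
      & forall m, clockwise v
          (ends (star v m).1 (~~ (star v m).2))
          (ends (star v (ordS m)).1 (~~ (star v (ordS m)).2))].

Lemma det_mx33_nat (f : nat -> nat -> int) : \det (\matrix_(i < 3, j < 3) f i j) =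
   f 0%N 0%N * (f 1%N 1%N * f 2%N 2%N - f 1%N 2%N * f 2%N 1%N)
 - f 0%N 1%N * (f 1%N 0%N * f 2%N 2%N - f 1%N 2%N * f 2%N 0%N)
 + f 0%N 2%N * (f 1%N 0%N * f 2%N 1%N - f 1%N 1%N * f 2%N 0%N) :> int.
Proof.
rewrite (expand_det_row _ ord0) !big_ord_recl big_ord0 /cofactor.
rewrite !(expand_det_row _ ord0) !big_ord_recl !big_ord0 /cofactor !det_mx11.
rewrite !mxE /= /bump /= !(expr0, expr1, exprS, mulr1, mul1r, mulN1r, mulrN, addr0, opprK).
by rewrite ?add0n ?add1n !mulrDr !mulrN ?opprD ?opprK ?mulrN ?addrA.
Qed.

Lemma clockwiseE v w w' (x : octV -> nat -> int := fun v j => (-1) ^+ v.2 * (v.1 == j :> nat)%:R) :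
  clockwise v w w' =
   (x v 0%N * (x w 1%N * x w' 2%N - x w 2%N * x w' 1%N)
  - x v 1%N * (x w 0%N * x w' 2%N - x w 2%N * x w' 0%N)
  + x v 2%N * (x w 0%N * x w' 1%N - x w 1%N * x w' 0%N) < 0).
Proof.
rewrite /clockwise.
rewrite -(det_mx33_nat (fun i j => x (nth v [:: v; w; w'] i) j)).
congr (\det _ < 0); apply/matrixP => i j; rewrite !mxE (tnth_nth 0) /=.
by case: i => [[|[|[|i]]] ?] //=; rewrite !mxE eqxx /= [in LHS]eq_sym.
Qed.

Definition oct_axis (v : octV) (k : nat) : 'I_3 := inord ((v.1 + k) %% 3)%N.
Definition oct_nbr (v : octV) (m : 'I_4) : octV :=
  nth (oct_axis v 1%N%N, false)
    [:: (oct_axis v 1%N%N, false); (oct_axis v 2%N%N, ~~ v.2); (oct_axis v 1%N%N, true); (oct_axis v 2%N%N, v.2)] m.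

Lemma oct_nbr_inj v : injective (oct_nbr v).
Proof.
move=> m m'; case: v => [[[|[|[|?]]] ?] []] //;
case: m => [[|[|[|[|?]]]] ?] //; case: m' => [[|[|[|[|?]]]] ?] //;
rewrite /oct_nbr /oct_axis /= => /eqP; rewrite xpair_eqE -val_eqE /= ?inordK //= => _; exact: val_inj.
Qed.

Lemma oct_nbr_adj v m : oct_adj v (oct_nbr v m).
Proof.
case: v => [[[|[|[|?]]] ?] []] //;
by case: m => [[|[|[|[|?]]]] ?] //; rewrite /oct_adj -val_eqE /= inordK.
Qed.

Lemma oct_nbr_clockwise v m : clockwise v (oct_nbr v m) (oct_nbr v (ordS m)).
Proof.
rewrite clockwiseE /oct_nbr /oct_axis.
by case: v => [[[|[|[|?]]] ?] []] //;
case: m => [[|[|[|[|?]]]] ?] //=; rewrite !inordK.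
Qed.

Lemma octahedron_realizable :
  exists ends star, oct_param ends /\ clockwise_numbering ends star.
Proof.
have exE (e : octE) : exists p : octV * octV, val e == [set p.1; p.2].
  have /existsP[v /existsP[w /andP[_ h]]] := valP e.
  by exists (v, w).
pose ends e (b : bool) := if b then (xchoose (exE e)).2 else (xchoose (exE e)).1.
have endsP : oct_param ends by move=> e; exact/eqP/(xchooseP (exE e)).
have edgeP v m : [exists a, exists b, oct_adj a b && ([set v; oct_nbr v m] == [set a; b])].
  by apply/existsP; exists v; apply/existsP; exists (oct_nbr v m); rewrite oct_nbr_adj eqxx.
pose edge v m : octE := Sub [set v; oct_nbr v m] (edgeP v m).
pose star v m := (edge v m, ends (edge v m) true == v).
have edgeV v m : [set v; oct_nbr v m] = [set ends (edge v m) false; ends (edge v m) true].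
  by rewrite -endsP.
have neq v m : v != oct_nbr v m.
  by apply/eqP => h; have := oct_nbr_adj v m; rewrite -h /oct_adj eqxx.
have near v m : ends (star v m).1 (star v m).2 = v.
  rewrite /star /=; case: eqP => // h.
  have : v \in [set v; oct_nbr v m] by rewrite !inE eqxx.
  by rewrite edgeV !inE => /orP[/eqP<-//|/eqP/esym].
have far v m : ends (star v m).1 (~~ (star v m).2) = oct_nbr v m.
  have : oct_nbr v m \in [set v; oct_nbr v m] by rewrite !inE eqxx orbT.
  rewrite edgeV !inE; have := near v m; rewrite /star /=.
  case: eqP => [h _|_ h] /= /orP[]/eqP E; try exact: esym.
    by case/eqP: (neq v m); exact: (etrans (esym h) (esym E)).
  by case/eqP: (neq v m); exact: (etrans (esym h) (esym E)).
exists ends, star; split=> // v; split=> //.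
  by move=> m m' h; apply: (@oct_nbr_inj v); rewrite -!far h.
by move=> m; rewrite !far oct_nbr_clockwise.
Qed.

(* Main.v *)
(* On each edge an eigenfunction is a combination of cos (k x) and sin (k x), so
   that an eigenspace is described by the boundary values P v w and outgoing
   derivatives Q v w on the 24 ordered pairs (v, w) of adjacent vertices.
   For k = 2 pi n, P is symmetric and Q antisymmetric, and the coupling says
   exactly that X = P + i Q satisfies X v w' = X w v, where w' is the clockwise
   successor of w around v: X is a function on the 8 faces.
   When sin k != 0, Q can be eliminated. The coupling at v kills the alternating
   sum of P v around v; Fourier analysis on the signs of v and w then decouples
   the remaining system into the sums over all signs, which are governed by
   (1 - cos k)(1 + 2 cos k), and three copies of a 5 x 5 block with determinant
   proportional to (1 + cos k + k^2 cos k)(cos k + k^2 (1 + cos k)).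
   So cos k = -1/2 has multiplicity two, and the other eigenvalues satisfy
   |cos k| <= 1/k^2 or 1 + cos k <= 1/k^2; the localization follows from
   y <= 2 sin y on [0, pi/2]. *)
Require Import Defs.
From HB Require Import structures.
From mathcomp Require Import all_boot all_order all_algebra.
From mathcomp Require Import complex.
From mathcomp Require Import all_classical all_reals all_analysis.
From mathcomp Require Import measurable_realfun ring lra.
Import Order.TTheory GRing.Theory Num.Theory.
Import numFieldNormedType.Exports.

Set Implicit Arguments.
Unset Strict Implicit.
Unset Printing Implicit Defensive.
Local Open Scope classical_set_scope.
Local Open Scope ring_scope.

(** * The harmonic oscillator on the unit interval *)

Section RealLine.
Variable R : realType.
Notation mu := (@lebesgue_measure R).
Implicit Types (f g u v w : R -> R) (x k : R).

Lemma ae_lebesgue_mono (P Q : R -> Prop) : (forall x, P x -> Q x) ->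
  {ae mu, forall x, P x} -> {ae mu, forall x, Q x}.
Proof.
by move=> PQ [N [mN N0 PN]]; exists N; split=> // x nQ; apply: PN => /PQ.
Qed.

(** On a set of finite measure L^2 lies in L^1, here by the pointwise bound |g| <= 1 + g^2; the
    endpoints of the closed interval are negligible. *)
Lemma L2_real_integrable g : L2_real g -> mu.-integrable `[0, 1] (EFin \o g).
Proof.
move=> g2; have /andP[+ _] := g2; rewrite inE /= => mg.
have mg' : measurable_fun (`]0, 1[ : set R) g.
  by apply/(measurable_restrictT _ (measurable_itv `]0, 1[)).
have i1 : mu.-integrable `]0, 1[ (EFin \o cst 1).
  apply/integrableP; split; first exact/measurable_EFinP.
  rewrite /= normr1 integral_cst //= mul1e lebesgue_measure_itv /= lte_fin ltr01.
  by rewrite -EFinB ltry.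
have ig : mu.-integrable `]0, 1[ (EFin \o (fun x => 1 + (g \_ `]0, 1[) x ^+ 2)).
  have i2 : mu.-integrable `]0, 1[ (EFin \o (fun x => (g \_ `]0, 1[) x ^+ 2)).
    by have := Lfun2_integrable_sqr g2; apply: integrableS => //; exact: measurable_itv.
  have := integrableD _ i1 i2; apply; exact: measurable_itv.
have /integrableP[mg1 fg] : mu.-integrable `]0, 1[ (EFin \o g).
  apply: le_integrable ig => //; first exact/measurable_EFinP.
  move=> x x01 /=; rewrite lee_fin patchE mem_set //.
  rewrite (ger0_norm (_ : 0 <= 1 + g x ^+ 2)); last by rewrite addr_ge0// sqr_ge0.
  rewrite -[X in _ <= _ + X]real_normK ?num_real//; have := normr_ge0 (g x); nra.
apply/integrableP; split.
  by apply/measurable_EFinP; exact: measurable_fun_itv_cc mg'.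
by rewrite integral_itv_bndoo //; apply: measurableT_comp.
Qed.

Lemma primitive_continuous f g : mu.-integrable `[0, 1] (EFin \o g) ->
  (forall x, 0 <= x <= 1 -> f x = f 0 + \int[mu]_(t in `[0, x]) g t) ->
  {within `[0, 1], continuous f}.
Proof.
move=> ig fE.
have cP := parameterized_integral_continuous (@ler01 R) ig.
have cQ : {within `[0, 1], continuous (fun x => f 0 + parameterized_integral mu 0 x g)}.
  by move=> x; apply: cvgD; [exact: cvg_cst|exact: cP].
apply: (subspace_eq_continuous _ cQ) => x; rewrite inE /= in_itv /= => x01.
exact: esym (fE _ x01).
Qed.

Lemma within_continuous_at f x : {within `[0, 1], continuous f} -> 0 < x < 1 ->
  {for x, continuous f}.
Proof.
move=> cf x01.
have : {within `]0, 1[, continuous f}.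
  by apply: continuous_subspaceW cf; exact: subset_itv_oo_cc.
by rewrite continuous_open_subspace // => /(_ x); apply; rewrite inE /= in_itv.
Qed.

Lemma primitive_derive f g x : mu.-integrable `[0, 1] (EFin \o g) ->
  (forall x, 0 <= x <= 1 -> f x = f 0 + \int[mu]_(t in `[0, x]) g t) ->
  {within `[0, 1], continuous g} -> 0 < x < 1 -> is_derive x 1 f (g x).
Proof.
move=> ig fE cg /[dup] x01 /andP[x0 x1].
have [dF F'] := continuous_FTC1_closed x1 ig x0 (within_continuous_at cg x01).
have dF' : is_derive x 1 (fun x => f 0 + \int[mu]_(t in `[0, x]) g t) (g x).
  apply: DeriveDef; first by apply: derivableD.
  by rewrite deriveD // derive_cst add0r -derive1E.
apply: near_eq_is_derive dF'.
near=> y; apply: esym; apply: fE; apply/andP; split; apply: ltW.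
  by near: y; exact: lt_nbhsr.
by near: y; exact: lt_nbhsl.
Unshelve. all: by end_near. Qed.


(** Once w is replaced by its continuous representative, u and v = u' are classical solutions. The
    vector (u, v/k), rotated back by the angle k x, then has zero derivative on (0,1) and keeps its
    initial value. *)
Lemma oscillator_unique k u v w : k != 0 ->
  mu.-integrable `[0, 1] (EFin \o v) -> mu.-integrable `[0, 1] (EFin \o w) ->
  (forall x, 0 <= x <= 1 -> u x = u 0 + \int[mu]_(t in `[0, x]) v t) ->
  (forall x, 0 <= x <= 1 -> v x = v 0 + \int[mu]_(t in `[0, x]) w t) ->
  {ae mu, forall x, x \in `]0, 1[ -> w x = - (k ^+ 2 * u x)} ->
  forall x, 0 <= x <= 1 ->
    u x = u 0 * cos (k * x) + v 0 / k * sin (k * x) /\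
    v x = v 0 * cos (k * x) - u 0 * k * sin (k * x).
Proof.
move=> k0 iv iw uE vE wE.
have cu := primitive_continuous iv uE; have cv := primitive_continuous iw vE.
have cw : {within `[0, 1], continuous (fun x => - (k ^+ 2 * u x))}.
  by move=> x; apply: cvgN; apply: cvgM; [exact: cvg_cst|exact: cu].
have iw' : mu.-integrable `[0, 1] (EFin \o (fun x => - (k ^+ 2 * u x))).
  exact: continuous_compact_integrable (@segment_compact _ _ _) cw.
(* The equation for w holds only almost everywhere, which suffices under the integral; with a
   continuous integrand the fundamental theorem of calculus applies to v. *)
have vE' x : 0 <= x <= 1 -> v x = v 0 + \int[mu]_(t in `[0, x]) (- (k ^+ 2 * u t)).
  move=> /[dup] x01 /andP[x0 x1]; rewrite vE //; congr (_ + fine _).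
  have m f : mu.-integrable `[0, 1] (EFin \o f) -> measurable_fun (`]0, x[ : set R) f.
    move=> /integrableP[/measurable_EFinP + _]; apply: measurable_funS => //.
    by move=> y /=; rewrite !in_itv /= => /andP[/ltW-> /ltW/le_trans->].
  have [mw mu'] := (m _ iw, m _ iw').
  rewrite integral_itv_bndoo; last exact/measurable_EFinP.
  rewrite [RHS]integral_itv_bndoo; last exact/measurable_EFinP.
  apply: ae_eq_integral => //; [exact/measurable_EFinP|exact/measurable_EFinP|].
  apply: ae_lebesgue_mono wE => y wy yx; congr EFin; apply: wy; move: yx.
  by rewrite /= !in_itv /= => /andP[-> /lt_le_trans->].
have du x : 0 < x < 1 -> is_derive x 1 u (v x) := primitive_derive iv uE cv.
have dv x : 0 < x < 1 -> is_derive x 1 v (- (k ^+ 2 * u x)) := primitive_derive iw' vE' cw.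
have dc x : is_derive x 1 (fun y => cos (k * y)) (- (k * sin (k * x))).
  apply: is_derive_eq; rewrite /= ?scaler0 ?addr0 /GRing.scale /=; ring.
have ds x : is_derive x 1 (fun y => sin (k * y)) (k * cos (k * x)).
  apply: is_derive_eq; rewrite /= ?scaler0 ?addr0 /GRing.scale /=; ring.
have cc : continuous (fun y : R => cos (k * y)).
  by move=> x; apply/differentiable_continuous/derivable1_diffP/(@ex_derive _ _ _ _ _ _ _ (dc x)).
have cs : continuous (fun y : R => sin (k * y)).
  by move=> x; apply/differentiable_continuous/derivable1_diffP/(@ex_derive _ _ _ _ _ _ _ (ds x)).
(* [A] and [B] are the two components of the rotated vector; the opposite rotation recovers u and v
   from them. *)
pose A x := u x * cos (k * x) - v x / k * sin (k * x).
pose B x := u x * sin (k * x) + v x / k * cos (k * x).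
have constant (F : R -> R) : (forall x, 0 < x < 1 -> is_derive x 1 F 0) ->
    {within `[0, 1], continuous F} -> forall x, 0 <= x <= 1 -> F x = F 0.
  move=> dF cF x /andP[x0 x1].
  have [y||c _] := @MVT_segment _ F (fun=> 0) 0 x x0.
  - by rewrite in_itv /= => /andP[y0 yx]; apply: dF; rewrite y0 (lt_le_trans yx).
  - by apply: continuous_subspaceW cF; apply: subset_itvl; rewrite bnd_simp.
  - by rewrite mul0r => /eqP; rewrite subr_eq0 => /eqP.
have AE x : 0 <= x <= 1 -> A x = u 0.
  move=> x01; rewrite (constant A _ _ x x01).
  - by rewrite /A mulr0 cos0 sin0; ring.
  - move=> y y01; have := du y y01; have := dv y y01 => dvy duy.
    apply: is_derive_eq; rewrite /GRing.scale /=; field; exact: k0.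
  - move=> y; apply: cvgB; apply: cvgM; [exact: cu|exact: continuous_subspaceT|apply: cvgM|].
    + exact: cv.
    + exact: cvg_cst.
    + exact: continuous_subspaceT.
have BE x : 0 <= x <= 1 -> B x = v 0 / k.
  move=> x01; rewrite (constant B _ _ x x01).
  - by rewrite /B mulr0 cos0 sin0; ring.
  - move=> y y01; have := du y y01; have := dv y y01 => dvy duy.
    apply: is_derive_eq; rewrite /GRing.scale /=; field; exact: k0.
  - move=> y; apply: cvgD; apply: cvgM; [exact: cu|exact: continuous_subspaceT|apply: cvgM|].
    + exact: cv.
    + exact: cvg_cst.
    + exact: continuous_subspaceT.
move=> x x01; rewrite -(AE x x01) -(BE x x01) /A /B.
have t := cos2Dsin2 (k * x).
have vk : v 0 = k * B x by rewrite BE // mulrC divfK.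
split.
  rewrite -[LHS]mulr1 -t; ring.
rewrite vk /B -[LHS]mulr1 -t; field; exact: k0.
Qed.

Lemma bounded_L2_real g (M : R) : measurable_fun (`]0, 1[ : set R) g ->
  (forall x, `|g x| <= M) -> L2_real g.
Proof.
move=> mg gM; rewrite /L2_real inE; apply/andP; split; rewrite inE /=.
  by apply/(measurable_restrictT _ (measurable_itv `]0, 1[)).
have mh : measurable_fun setT (g \_ `]0, 1[).
  by apply/(measurable_restrictT _ (measurable_itv `]0, 1[)).
rewrite /finite_norm unlock; apply: poweR_lty.
have m01 : measurable (`]0, 1[ : set (measurableTypeR R)) by exact: measurable_itv.
apply: (@le_lt_trans _ _ (\int[mu]_x ((cst (M ^+ 2)) \_ `]0, 1[ x)%:E)%E).
  apply: ge0_le_integral => //=.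
  - apply/measurable_EFinP.
    apply: (@measurableT_comp _ _ _ _ _ _ (fun y : R => y `^ 2)) => //.
    exact: (measurableT_comp (@normr_measurable R setT) mh).
  - apply/measurable_EFinP/(measurable_restrictT _ (measurable_itv `]0, 1[)).
    exact: measurable_cst.
  - move=> x _; rewrite patchE [in leRHS]patchE; case: ifP => _; last first.
      by rewrite normr0 powR0.
    by rewrite lee_fin powR_mulrn // lerXn2r ?nnegrE // (le_trans _ (gM x)).
have -> : (fun x => ((cst (M ^+ 2)) \_ `]0, 1[ x)%:E) = (cst (M^+2)%:E) \_ `]0, 1[.
  by apply/funext => x; rewrite !patchE; case: ifP.
rewrite -integral_mkcond integral_cst //= lebesgue_measure_itv /= lte_fin ltr01.
by rewrite -EFinB -EFinM ltry.
Qed.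

Definition osc k (a b : R) x : R := a * cos (k * x) + b * sin (k * x).

Lemma is_derive_osc k a b x : is_derive x 1 (osc k a b) (osc k (k * b) (- (k * a)) x).
Proof.
rewrite /osc; apply: is_derive_eq; rewrite /= ?scaler0 ?addr0 /GRing.scale /=; ring.
Qed.

Lemma continuous_osc k a b : continuous (osc k a b).
Proof.
by move=> x; apply/differentiable_continuous/derivable1_diffP/(@ex_derive _ _ _ _ _ _ _ (is_derive_osc k a b x)).
Qed.

Lemma L2_real_osc k a b : L2_real (osc k a b).
Proof.
apply: (@bounded_L2_real _ (`|a| + `|b|)).
  apply: measurable_funTS; apply: continuous_measurable_fun; exact: continuous_osc.
move=> x; apply: (le_trans (ler_normD _ _)); rewrite !normrM.
by apply: lerD; apply: ler_piMr => //; [exact: cos_max|exact: sin_max].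
Qed.

Lemma osc_primitive k a b x : 0 <= x ->
  osc k a b x = osc k a b 0 + \int[mu]_(t in `[0, x]) osc k (k * b) (- (k * a)) t.
Proof.
rewrite le_eqVlt => /orP[/eqP<-|x0]; first by rewrite set_itv1 Rintegral_set1 addr0.
have c a' b' := @continuous_osc k a' b'.
rewrite /Rintegral (continuous_FTC2 (F := osc k a b) x0).
- by rewrite -EFinB /= addrC subrK.
- exact: continuous_subspaceT.
- split.
  + by move=> y _; apply: ex_derive; exact: is_derive_osc.
  + exact/cvg_at_right_filter/c.
  + exact/cvg_at_left_filter/c.
- by move=> y _; rewrite derive1E; apply: derive_val; exact: is_derive_osc.
Qed.

(** Otherwise the null exceptional set would contain the interval ]a, b[, which has positive
    measure. *)
Lemma ae_pick (P : R -> Prop) a b : {ae mu, forall x, x \in `]0, 1[ -> P x} ->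
  0 <= a -> a < b -> b <= 1 -> exists2 x, a < x < b & P x.
Proof.
move=> [N [mN N0 PN]] a0 ab b1; apply: contrapT => nP.
have sub : (`]a, b[ : set R) `<=` N.
  move=> x /=; rewrite in_itv /= => xab; apply: PN => Px; apply: nP.
  exists x => //; apply: Px; case/andP: xab => ax xb.
  by rewrite in_itv /= (le_lt_trans a0) // (lt_le_trans xb).
have : (mu `]a, b[ <= mu N)%E.
  by apply: le_measure => //; rewrite inE.
by rewrite N0 lebesgue_measure_itv /= lte_fin ab -EFinB lee_fin subr_le0 leNgt ab.
Qed.

End RealLine.

(** * Complex-valued solutions on one edge *)

Section ComplexLine.
Variable R : realType.
Notation mu := (@lebesgue_measure R).
Notation C := R[i].
Local Notation cRe := (@complex.Re R).
Local Notation cIm := (@complex.Im R).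
Local Notation "x %:C" := (real_complex R x) : ring_scope.
Implicit Types (a b : C) (f g : R -> C) (k x : R).

Definition cosc k a b x : C := a * (cos (k * x))%:C + b * (sin (k * x))%:C.

Lemma ReMr a x : cRe (a * x%:C) = cRe a * x.
Proof. by case: a => p q /=; rewrite mulr0 subr0. Qed.

Lemma ImMr a x : cIm (a * x%:C) = cIm a * x.
Proof. by case: a => p q /=; rewrite mulr0 add0r. Qed.

Lemma ReD a b : cRe (a + b) = cRe a + cRe b.
Proof. by case: a b => [p q] []. Qed.

Lemma ImD a b : cIm (a + b) = cIm a + cIm b.
Proof. by case: a b => [p q] []. Qed.

Lemma ReN a : cRe (- a) = - cRe a.
Proof. by case: a. Qed.

Lemma ImN a : cIm (- a) = - cIm a.
Proof. by case: a. Qed.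

Lemma complex_ext a b :
  cRe a = cRe b -> cIm a = cIm b -> a = b.
Proof. by case: a b => [p q] [p' q'] /= -> ->. Qed.

Lemma Re_cosc k a b : cRe \o cosc k a b = osc k (cRe a) (cRe b).
Proof. by apply/funext => x; rewrite /cosc /= ReD !ReMr. Qed.

Lemma Im_cosc k a b : cIm \o cosc k a b = osc k (cIm a) (cIm b).
Proof. by apply/funext => x; rewrite /cosc /= ImD !ImMr. Qed.

Lemma cosc0 k a b : cosc k a b 0 = a.
Proof. by rewrite /cosc mulr0 cos0 sin0 !rmorph0 mulr0 addr0 rmorph1 mulr1. Qed.

Lemma W12_cosc k a b : W12 (cosc k a b) (cosc k (b * k%:C) (- (a * k%:C))).
Proof.
split.
  by split; rewrite -/(_ \o _) ?Re_cosc ?Im_cosc; exact: L2_real_osc.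
move=> x /andP[x0 _]; rewrite /cint; apply: complex_ext.
- rewrite ReD /= -[LHS]/((cRe \o cosc k a b) x) -[X in X + _]/((cRe \o cosc k a b) 0).
  rewrite Re_cosc osc_primitive //; congr (_ + _); apply: eq_Rintegral => t _.
  by rewrite -[RHS]/((cRe \o _) t) Re_cosc ReMr ReN ReMr !(mulrC k).
- rewrite ImD /= -[LHS]/((cIm \o cosc k a b) x) -[X in X + _]/((cIm \o cosc k a b) 0).
  rewrite Im_cosc osc_primitive //; congr (_ + _); apply: eq_Rintegral => t _.
  by rewrite -[RHS]/((cIm \o _) t) Im_cosc ImMr ImN ImMr !(mulrC k).
Qed.

Lemma W12_Re f g : W12 f g ->
  mu.-integrable `[0, 1] (EFin \o (cRe \o g)) /\
  forall x, 0 <= x <= 1 ->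
    (cRe \o f) x = (cRe \o f) 0 + \int[mu]_(t in `[0, x]) (cRe \o g) t.
Proof.
move=> [[g2 _] fE]; split; first exact: L2_real_integrable g2.
by move=> x x01 /=; rewrite {1}fE // ReD.
Qed.

Lemma W12_Im f g : W12 f g ->
  mu.-integrable `[0, 1] (EFin \o (cIm \o g)) /\
  forall x, 0 <= x <= 1 ->
    (cIm \o f) x = (cIm \o f) 0 + \int[mu]_(t in `[0, x]) (cIm \o g) t.
Proof.
move=> [[_ g2] fE]; split; first exact: L2_real_integrable g2.
by move=> x x01 /=; rewrite {1}fE // ImD.
Qed.

(** As k^2 is real, the real and imaginary parts of f solve the real oscillator equation
    separately. *)
Lemma W22_eigenE k f f1 f2 : k != 0 -> W22 f f1 f2 ->
  {ae mu, forall x, x \in `]0, 1[ -> (k ^+ 2)%:C * f x - (- f2 x) = 0} ->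
  forall x, 0 <= x <= 1 ->
    f x = cosc k (f 0) (f1 0 / k%:C) x /\
    f1 x = cosc k (f1 0) (- (f 0 * k%:C)) x.
Proof.
move=> k0 [/[dup] /W12_Re[rv ru] /W12_Im[iv iu] /[dup] /W12_Re[rw rE] /W12_Im[iw iE]] wE x x01.
have [r1 r2] : (cRe \o f) x = osc k (cRe (f 0)) (cRe (f1 0) / k) x /\
    (cRe \o f1) x = osc k (cRe (f1 0)) (- (cRe (f 0) * k)) x.
  have [|-> ->] := oscillator_unique k0 rv rw ru rE _ x01; last by rewrite /osc mulNr.
  apply: ae_lebesgue_mono wE => y + y01 => /(_ y01) /eqP.
  rewrite opprK addr_eq0 => /eqP h; apply: oppr_inj; rewrite /= -ReN -h opprK.
  by rewrite mulrC ReMr mulrC.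
have [i1 i2] : (cIm \o f) x = osc k (cIm (f 0)) (cIm (f1 0) / k) x /\
    (cIm \o f1) x = osc k (cIm (f1 0)) (- (cIm (f 0) * k)) x.
  have [|-> ->] := oscillator_unique k0 iv iw iu iE _ x01; last by rewrite /osc mulNr.
  apply: ae_lebesgue_mono wE => y + y01 => /(_ y01) /eqP.
  rewrite opprK addr_eq0 => /eqP h; apply: oppr_inj; rewrite /= -ImN -h opprK.
  by rewrite mulrC ImMr mulrC.
split; apply: complex_ext.
- rewrite -[RHS]/((cRe \o cosc _ _ _) x) Re_cosc -fmorphV ReMr; exact: r1.
- rewrite -[RHS]/((cIm \o cosc _ _ _) x) Im_cosc -fmorphV ImMr; exact: i1.
- rewrite -[RHS]/((cRe \o cosc _ _ _) x) Re_cosc ReN ReMr; exact: r2.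
- rewrite -[RHS]/((cIm \o cosc _ _ _) x) Im_cosc ImN ImMr; exact: i2.
Qed.

(** Vanishing at two points x < y gives a linear system for a and b with determinant sin (k (y -
    x)), which is nonzero when the points are less than half a period apart. *)
Lemma cosc_ae0 k a b : 0 < k ->
  {ae mu, forall x, x \in `]0, 1[ -> cosc k a b x = 0} -> a = 0 /\ b = 0.
Proof.
move=> k0 ab0.
(* One point is taken in each half of ]0, t[, so that 0 < k (y - x) < pi. *)
pose t := Num.min 1 (pi / k).
have t0 : 0 < t by rewrite lt_min ltr01 divr_gt0 ?pi_gt0.
have t1 : t <= 1 by rewrite ge_min lexx.
have kt : k * t <= pi by rewrite mulrC -ler_pdivlMr // ge_min lexx orbT.
have t2 : 0 < t / 2 by rewrite divr_gt0.
have t2t : t / 2 < t by lra.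
have [x /andP[x0 xt] fx] := ae_pick ab0 (lexx 0) t2 (le_trans (ltW t2t) t1).
have [y /andP[ty yt] fy] := ae_pick ab0 (ltW t2) t2t t1.
have s0 : (sin (k * y - k * x))%:C != 0 :> C.
  rewrite fmorph_eq0 gt_eqF // sin_gt0_pi // -mulrBr mulr_gt0 ?subr_gt0 //=; last lra.
  by apply: lt_le_trans kt; rewrite ltr_pM2l //; lra.
rewrite sinB rmorphB !rmorphM /= in s0.
have ea : a * ((sin (k * y))%:C * (cos (k * x))%:C - (cos (k * y))%:C * (sin (k * x))%:C)
    = (sin (k * y))%:C * cosc k a b x - (sin (k * x))%:C * cosc k a b y.
  by rewrite /cosc; ring.
have eb : b * ((sin (k * y))%:C * (cos (k * x))%:C - (cos (k * y))%:C * (sin (k * x))%:C)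
    = (cos (k * x))%:C * cosc k a b y - (cos (k * y))%:C * cosc k a b x.
  by rewrite /cosc; ring.
move: ea eb; rewrite fx fy !mulr0 subrr => /eqP + /eqP.
by rewrite !mulf_eq0 (negPf s0) !orbF => /eqP-> /eqP->.
Qed.

End ComplexLine.

(** * Darts of the octahedron *)

(** The clockwise successor of w around v: it lies on the remaining axis, with the sign that makes
    the determinant in [clockwise] negative. The value is meaningful for adjacent v and w only. *)
Definition cw_next (v w : octV) : octV :=
  if w.1 == ordS v.1 then (ordS w.1, ~~ (v.2 (+) w.2)) else (ordS v.1, v.2 (+) w.2).

Lemma clockwise_next v w w' : clockwise v w w' -> w' = cw_next v w.
Proof.
rewrite clockwiseE /cw_next.
by case: v w w' => [[[|[|[|?]]] ?] []] [[[|[|[|?]]] ?] []] [[[|[|[|?]]] ?] []] //= _;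
  congr pair; exact: val_inj.
Qed.

Lemma cw_next_adj v w : oct_adj v w -> oct_adj v (cw_next v w).
Proof.
rewrite /cw_next /oct_adj.
by case: v w => [[[|[|[|?]]] ?] []] [[[|[|[|?]]] ?] []].
Qed.

(** The four neighbours of v form a single cycle under [cw_next v]; this is what makes a clockwise
    numbering exhaust them. *)
Lemma cw_next_orbit v w w' : oct_adj v w -> oct_adj v w' ->
  exists j : 'I_4, w' = iter j (cw_next v) w.
Proof.
rewrite /oct_adj => vw vw'.
suff : [|| w' == w, w' == cw_next v w, w' == cw_next v (cw_next v w) | w' == cw_next v (cw_next v (cw_next v w))].
  case/or4P => /eqP->; first by exists (inord 0); rewrite inordK.
  - by exists (inord 1); rewrite inordK.
  - by exists (inord 2); rewrite inordK.
  - by exists (inord 3); rewrite inordK.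
move: vw vw'; rewrite /cw_next.
by case: v w w' => [[[|[|[|?]]] ?] []] [[[|[|[|?]]] ?] []] [[[|[|[|?]]] ?] []].
Qed.

Section Darts.
Variables (ends : octE -> bool -> octV) (star : octV -> 'I_4 -> octE * bool).
Hypotheses (Hends : oct_param ends) (Hstar : clockwise_numbering ends star).

(** A boundary point of an edge is read as a dart, the edge directed away from that endpoint. *)
Definition dart_tail (p : octE * bool) := ends p.1 p.2.
Definition dart_head (p : octE * bool) := ends p.1 (~~ p.2).

Lemma oct_adj_sym v w : oct_adj v w = oct_adj w v.
Proof. by rewrite /oct_adj eq_sym. Qed.

Lemma dart_adj p : oct_adj (dart_tail p) (dart_head p).
Proof.
suff h e : oct_adj (ends e false) (ends e true).
  by case: p => e []; rewrite /dart_tail /dart_head /= ?h // oct_adj_sym.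
have /existsP[v /existsP[w /andP[vw /eqP E]]] := valP e.
have : v \in val e by rewrite E !inE eqxx.
have : w \in val e by rewrite E !inE eqxx orbT.
rewrite Hends !inE => /orP[]/eqP ? /orP[]/eqP ?; subst v w => //.
- by rewrite /oct_adj eqxx in vw.
- by rewrite oct_adj_sym.
- by rewrite /oct_adj eqxx in vw.
Qed.

Lemma dart_exists v w : oct_adj v w -> exists2 p, dart_tail p = v & dart_head p = w.
Proof.
move=> vw.
have eP : [exists a, exists b, oct_adj a b && ([set v; w]%SET == [set a; b]%SET)].
  by apply/existsP; exists v; apply/existsP; exists w; rewrite vw eqxx.
pose e : octE := Sub [set v; w]%SET eP.
have nvw : v != w by apply: contraNneq (vw) => ->; rewrite /oct_adj eqxx.
have := Hends e; rewrite /= => E.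
have : v \in [set v; w]%SET by rewrite !inE eqxx.
have : w \in [set v; w]%SET by rewrite !inE eqxx orbT.
rewrite E !inE => /orP[]/eqP ew /orP[]/eqP ev.
- by rewrite ew ev eqxx in nvw.
- by exists (e, true); rewrite /dart_tail /dart_head /=.
- by exists (e, false); rewrite /dart_tail /dart_head /=.
- by rewrite ew ev eqxx in nvw.
Qed.

(** The graph has neither loops nor multiple edges; hence data on boundary points can be written as
    functions of ordered pairs of adjacent vertices. *)
Lemma dart_inj p q : dart_tail p = dart_tail q -> dart_head p = dart_head q -> p = q.
Proof.
have := dart_adj p; case: p q => e b [e' b']; rewrite /dart_tail /dart_head /= => adj t h.
have ee : e = e'.
  apply: val_inj; rewrite !Hends; case: b b' t h {adj} => -[] /= -> -> //;
  exact: finset.setUC.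
subst e'; congr pair; move: adj; rewrite /oct_adj.
by case: b b' t h => -[] //= -> _; rewrite eqxx.
Qed.

Lemma star_tail v m : dart_tail (star v m) = v.
Proof. by have [_ h _] := Hstar v; exact: h. Qed.

Lemma star_head v m : dart_head (star v (ordS m)) = cw_next v (dart_head (star v m)).
Proof.
have [_ t h] := Hstar v; apply: clockwise_next; exact: h.
Qed.

(** The numbering at a vertex advances by [cw_next], and by [cw_next_orbit] it thus reaches every
    neighbour. *)
Lemma star_surj p : exists m, p = star (dart_tail p) m.
Proof.
set v := dart_tail p.
have adj0 : oct_adj v (dart_head (star v ord0)) by rewrite -[X in oct_adj X](star_tail v ord0) dart_adj.
have [j hj] := cw_next_orbit adj0 (dart_adj p).
exists (iter j (@ordS 4) ord0); apply: dart_inj; first by rewrite star_tail.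
rewrite hj; elim: {hj}(nat_of_ord j) => //= n ->; by rewrite star_head.
Qed.

(** Pairs of vertices that are not joined by an edge receive the default [x0]. *)
Definition on_darts (T : Type) (x0 : T) (phi : octE * bool -> T) (v w : octV) : T :=
  if [pick p | (dart_tail p == v) && (dart_head p == w)] is Some p then phi p else x0.

Lemma on_dartsE T x0 phi p : @on_darts T x0 phi (dart_tail p) (dart_head p) = phi p.
Proof.
rewrite /on_darts; case: pickP => [q /andP[/eqP t /eqP h]|/(_ p)]; last by rewrite !eqxx.
by rewrite (dart_inj t h).
Qed.

End Darts.

(** * Eigenfunctions and their boundary data *)

Section Spectrum.
Variable R : realType.
Notation C := R[i].
Local Notation "x %:C" := (real_complex R x) : ring_scope.
Implicit Types (P Q : octV -> octV -> C) (k x : R).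

Lemma coupling_cyclicP (V E : finType) d (star : V -> 'I_d -> E * bool)
    (f f1 : E -> R -> C) v :
  coupling star (fun=> cyclic_mx R d) f f1 v <->
  forall m, boundary_value f (star v (ordS m)) - boundary_value f (star v m)
    + 'i%C * (outgoing_derivative f1 (star v (ordS m)) +
              outgoing_derivative f1 (star v m)) = 0.
Proof.
have perm (A : 'cV[C]_d) m : \sum_j cyclic_mx R d m j * A j 0 = A (ordS m) 0.
  rewrite (bigD1 (ordS m)) //= mxE eqxx mul1r big1 ?addr0 // => j jm.
  by rewrite mxE (negPf jm) mul0r.
have entry (A B : 'cV[C]_d) m :
    ((cyclic_mx R d - 1%:M) *m A + 'i%C *: ((cyclic_mx R d + 1%:M) *m B)) m 0 =
    A (ordS m) 0 - A m 0 + 'i%C * (B (ordS m) 0 + B m 0).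
  by rewrite mulmxBl mulmxDl !mul1mx !mxE !perm.
rewrite /coupling; split=> [H m|H].
  by have := congr1 (fun A : 'cV[C]_d => A m 0) H; rewrite /= entry !mxE.
by apply/colP => m; rewrite entry !mxE.
Qed.

(** The two flips describe propagation along an edge of length 1. With outgoing derivatives the
    propagation is an involution of the same form from either end, so the direction chosen on an
    edge drops out. *)
Record boundary_data k P Q : Prop := BoundaryData {
  value_flip : forall v w, oct_adj v w ->
    P w v = P v w * (cos k)%:C + Q v w * (sin k / k)%:C;
  derivative_flip : forall v w, oct_adj v w ->
    Q w v = P v w * (k * sin k)%:C - Q v w * (cos k)%:C;
  value_turn : forall v w, oct_adj v w ->
    P v (cw_next v w) - P v w + 'i%C * (Q v (cw_next v w) + Q v w) = 0 }.

Variables (ends : octE -> bool -> octV) (star : octV -> 'I_4 -> octE * bool).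
Hypotheses (Hends : oct_param ends) (Hstar : clockwise_numbering ends star).

Definition edge_functions k P Q (e : octE) : R -> C :=
  cosc k (P (ends e false) (ends e true)) (Q (ends e false) (ends e true) / k%:C).

Notation eigenspace k := (in_eigenspace star (fun=> cyclic_mx R 4) (k ^+ 2)%:C).

Lemma edge_functions_eigen k P Q : k != 0 -> boundary_data k P Q ->
  eigenspace k (edge_functions k P Q).
Proof.
move=> k0 [PE QE turn].
have kC0 : k%:C != 0 :> C by rewrite fmorph_eq0.
pose a e := P (ends e false) (ends e true).
pose b e := Q (ends e false) (ends e true) / k%:C.
exists (fun e => cosc k (b e * k%:C) (- (a e * k%:C))).
exists (fun e => cosc k (- (a e * k%:C) * k%:C) (- (b e * k%:C * k%:C))).
have adj e : oct_adj (ends e false) (ends e true) := dart_adj Hends (e, false).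
have bv p : boundary_value (edge_functions k P Q) p = P (dart_tail ends p) (dart_head ends p).
  case: p => e [] /=; rewrite /boundary_value /dart_tail /dart_head /= /edge_functions ?cosc0 //.
  by rewrite [RHS]PE // /cosc mulr1 -mulrA -fmorphV -rmorphM [k^-1 * _]mulrC.
have od p : outgoing_derivative (fun e => cosc k (b e * k%:C) (- (a e * k%:C))) p =
    Q (dart_tail ends p) (dart_head ends p).
  case: p => e [] /=; rewrite /outgoing_derivative /dart_tail /dart_head /=; last first.
    by rewrite cosc0 /b divfK.
  by rewrite [RHS]QE // /cosc /a /b mulr1 divfK // rmorphM; ring.
split.
- by move=> e; split; exact: W12_cosc.
- move=> v; apply/coupling_cyclicP => m; rewrite !bv !od.
  have := star_head Hstar v m; rewrite !(star_tail Hstar) => ->.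
  by apply: turn; rewrite -{1}(star_tail Hstar v m); exact: dart_adj.
- move=> e; apply: aeW => x _; rewrite /edge_functions /cosc -/(a e) -/(b e) rmorphXn; ring.
Qed.

Lemma eigen_edge_functions k f : k != 0 -> eigenspace k f ->
  exists P Q, boundary_data k P Q /\
    forall e x, 0 <= x <= 1 -> f e x = edge_functions k P Q e x.
Proof.
move=> k0 [f1 [f2 [W22f coup eig]]].
have kC0 : k%:C != 0 :> C by rewrite fmorph_eq0.
pose P := on_darts ends 0 (boundary_value f).
pose Q := on_darts ends 0 (outgoing_derivative f1).
have PE p : P (dart_tail ends p) (dart_head ends p) = boundary_value f p by exact: on_dartsE.
have QE p : Q (dart_tail ends p) (dart_head ends p) = outgoing_derivative f1 p by exact: on_dartsE.
have sol e x : 0 <= x <= 1 -> f e x = cosc k (f e 0) (f1 e 0 / k%:C) x /\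
    f1 e x = cosc k (f1 e 0) (- (f e 0 * k%:C)) x.
  exact: (W22_eigenE k0 (W22f e) (eig e)).
have r11 : 0 <= (1 : R) <= 1 by rewrite ler01 lexx.
exists P, Q; split; last first.
  move=> e x x01; have [-> _] := sol e x x01; rewrite /edge_functions.
  by have /= -> := PE (e, false); have /= -> := QE (e, false).
(* This identity serves the darts based at x = 1, for which the propagation from 0 to 1 has to be
   inverted. *)
have t := congr1 (real_complex R) (cos2Dsin2 k).
rewrite rmorphD !rmorphXn rmorph1 /= in t.
split=> v w vw.
- have [p <- <-] := dart_exists Hends vw.
  (* The reversed pair of vertices is presented as the dart at the other endpoint of the same
     edge. *)
  rewrite -[P (dart_head _ _) _]/(P (dart_tail ends (p.1, ~~ p.2)) (ends p.1 p.2)) -{2}[p.2]negbK.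
  rewrite PE QE (PE (p.1, ~~ p.2)).
  have [e1 e2] := sol p.1 1 r11.
  rewrite /boundary_value /outgoing_derivative; case: p.2 => /=; rewrite e1 ?e2 /cosc mulr1 rmorphM fmorphV.
    by rewrite -[LHS]mulr1 -t; field.
  by field.
- have [p <- <-] := dart_exists Hends vw.
  rewrite -[Q (dart_head _ _) _]/(Q (dart_tail ends (p.1, ~~ p.2)) (ends p.1 p.2)) -{2}[p.2]negbK.
  rewrite PE QE (QE (p.1, ~~ p.2)).
  have [e1 e2] := sol p.1 1 r11.
  rewrite /boundary_value /outgoing_derivative; case: p.2 => /=; rewrite e2 ?e1 /cosc mulr1 rmorphM.
    by rewrite -[LHS]mulr1 -t; field.
  by field.
- have [p <- <-] := dart_exists Hends vw.
  have [m pm] := star_surj Hends Hstar p.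
  have /coupling_cyclicP/(_ m) := coup (dart_tail ends p).
  by rewrite -!PE -!QE star_head // -pm star_tail.
Qed.

End Spectrum.

(** * The secular system for sin k != 0 *)

Section CyclicSystem.
Variables (F : numFieldType) (J : F).

(** A real form of the Fourier transform on Z/4: the four equations are combined with the signs
    -+-+, ++++, -++- and --++. Here x_m are the values at a vertex along its four edges, and r_m is
    the outgoing derivative up to the factor k / sin k. *)
Lemma cyclic_system x0 x1 x2 x3 r0 r1 r2 r3 : J != 0 ->
  x1 - x0 + J * (r1 + r0) = 0 -> x2 - x1 + J * (r2 + r1) = 0 ->
  x3 - x2 + J * (r3 + r2) = 0 -> x0 - x3 + J * (r0 + r3) = 0 ->
  [/\ x0 + x2 = x1 + x3, r0 + r1 + r2 + r3 = 0,
      x3 - x1 = J * (r0 - r2) & x0 - x2 = J * (r1 - r3)].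
Proof.
move=> J0 e0 e1 e2 e3.
have n2 : (2 : F) != 0 by rewrite pnatr_eq0.
split; apply/eqP; rewrite -subr_eq0.
- apply/eqP/(mulfI n2); rewrite mulr0.
  rewrite (_ : _ * _ = - (x1 - x0 + J * (r1 + r0)) + (x2 - x1 + J * (r2 + r1))
    - (x3 - x2 + J * (r3 + r2)) + (x0 - x3 + J * (r0 + r3))); last by ring.
  by rewrite e0 e1 e2 e3; ring.
- apply/eqP/(mulfI n2)/(mulfI J0); rewrite !mulr0.
  rewrite (_ : _ * _ = (x1 - x0 + J * (r1 + r0)) + (x2 - x1 + J * (r2 + r1))
    + (x3 - x2 + J * (r3 + r2)) + (x0 - x3 + J * (r0 + r3))); last by ring.
  by rewrite e0 e1 e2 e3; ring.
- apply/eqP/(mulfI n2); rewrite mulr0.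
  rewrite (_ : _ * _ = - (x1 - x0 + J * (r1 + r0)) + (x2 - x1 + J * (r2 + r1))
    + (x3 - x2 + J * (r3 + r2)) - (x0 - x3 + J * (r0 + r3))); last by ring.
  by rewrite e0 e1 e2 e3; ring.
- apply/eqP/(mulfI n2); rewrite mulr0.
  rewrite (_ : _ * _ = - (x1 - x0 + J * (r1 + r0)) - (x2 - x1 + J * (r2 + r1))
    + (x3 - x2 + J * (r3 + r2)) + (x0 - x3 + J * (r0 + r3))); last by ring.
  by rewrite e0 e1 e2 e3; ring.
Qed.

(** Sums and differences decouple: x + y and p - q determine each other, which the first factor
    excludes unless both vanish; p + q and y - x are multiples of a, and the second factor forces a
    = 0. *)
Lemma block_system c x y p q a :
  1 - J ^+ 2 * (c * (1 - c)) != 0 ->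
  c - J ^+ 2 * ((1 + c) * (1 - c ^+ 2)) != 0 ->
  p = J * (y - c * x) -> q = - (J * (x - c * y)) ->
  x = - (J * (a - c * p)) -> y = J * (a - c * q) -> p + q = 2 * (c * a) ->
  [/\ x = 0, y = 0, p = 0, q = 0 & a = 0].
Proof.
move=> d1 d2 pE qE xE yE pq.
have n2 : (2 : F) != 0 by rewrite pnatr_eq0.
have pmq : p - q = J * ((1 - c) * (x + y)) by rewrite pE qE; ring.
have ppq : p + q = J * ((1 + c) * (y - x)) by rewrite pE qE; ring.
have xpy : x + y = J * (c * (p - q)) by rewrite xE yE; ring.
have ymx : y - x = J * (2 * a - c * (p + q)) by rewrite xE yE; ring.
have s0 : x + y = 0.
  apply: (mulfI d1); rewrite mulr0 mulrBl mul1r {1}xpy pmq; ring.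
have a0 : a = 0.
  apply: (mulfI d2); apply: (mulfI n2); rewrite !mulr0 mulrBl mulrBr -pq.
  rewrite ppq ymx pq; ring.
have dx : y - x = 0 by rewrite ymx pq a0; ring.
have x0 : x = 0 by apply: (mulfI n2); rewrite mulr0 -[RHS]s0 -[RHS]subr0 -dx; ring.
have y0 : y = 0 by move: s0; rewrite x0 add0r.
by split=> //; rewrite ?pE ?qE x0 y0; ring.
Qed.

End CyclicSystem.

(** * Fourier analysis on the signs of the vertices *)

Section OctahedronSystem.
Variable R : realType.
Notation C := R[i].
Local Notation "x %:C" := (real_complex R x) : ring_scope.
Implicit Types (P Q : octV -> octV -> C) (k x : R).

Lemma ordS3K (i : 'I_3) : ordS (ordS (ordS i)) = i.
Proof. by apply: val_inj; case: i => [[|[|[|?]]] ?]. Qed.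

Lemma ordS3_neq (i : 'I_3) : i != ordS i.
Proof. by case: i => [[|[|[|?]]] ?]. Qed.

Lemma ordS3_neq2 (i : 'I_3) : i != ordS (ordS i).
Proof. by case: i => [[|[|[|?]]] ?]. Qed.

Lemma ord3_cases (i j : 'I_3) : i != j -> j = ordS i \/ j = ordS (ordS i).
Proof.
by case: i j => [[|[|[|?]]] ?] [[|[|[|?]]] ?] //= _; ((by left; apply: val_inj) || (by right; apply: val_inj)).
Qed.

Lemma cw_next_succ (i : 'I_3) a b :
  cw_next (i, a) (ordS i, b) = (ordS (ordS i), ~~ (a (+) b)).
Proof. by rewrite /cw_next /= eqxx. Qed.

Lemma cw_next_pred (i : 'I_3) a b : cw_next (i, a) (ordS (ordS i), b) = (ordS i, a (+) b).
Proof. by rewrite /cw_next /= eq_sym (negPf (ordS3_neq _)). Qed.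

(** The Fourier transform on (Z/2)^2 in the signs of the two vertices with their axes fixed; [al]
    and [be] choose the even (false) or odd (true) character in each sign. *)
Definition parity_sum P (i j : 'I_3) (al be : bool) : C :=
  P (i, false) (j, false) + (-1) ^+ be * P (i, false) (j, true) +
  (-1) ^+ al * (P (i, true) (j, false) + (-1) ^+ be * P (i, true) (j, true)).

Lemma parity_sum_inv P i j a b : P (i, a) (j, b) =
  (parity_sum P i j false false + (-1) ^+ b * parity_sum P i j false true +
   (-1) ^+ a * (parity_sum P i j true false + (-1) ^+ b * parity_sum P i j true true)) / 4.
Proof.
have n4 : (4 : C) != 0 by rewrite pnatr_eq0.
by rewrite /parity_sum; case: a b => -[] /=; rewrite ?expr0 ?expr1; field.
Qed.

(* J stands for i k / sin k. *)
Lemma parity_system P c J : J != 0 ->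
  (forall v w, oct_adj v w -> P v (cw_next v w) - P v w +
     J * ((P (cw_next v w) v - c * P v (cw_next v w)) + (P w v - c * P v w)) = 0) ->
  forall (i : 'I_3) (al : bool), let j := ordS i in let l := ordS j in
  [/\ parity_sum P i j al false = parity_sum P i l al false,
      parity_sum P j i false al + parity_sum P l i false al =
        2 * (c * parity_sum P i j al false),
      parity_sum P i l al true =
        J * (parity_sum P j i true (~~ al) - c * parity_sum P i j (~~ al) true)
    & parity_sum P i j al true =
        - (J * (parity_sum P l i true (~~ al) - c * parity_sum P i l (~~ al) true))].
Proof.
move=> J0 T i al j l.
have adj_j a b : oct_adj (i, a) (j, b) by exact: ordS3_neq.
have adj_l a b : oct_adj (i, a) (l, b) by exact: ordS3_neq2.
have Tj a b := T _ _ (adj_j a b); have Tl a b := T _ _ (adj_l a b).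
have {}Tj a b : P (i, a) (l, ~~ (a (+) b)) - P (i, a) (j, b) +
    J * (P (l, ~~ (a (+) b)) (i, a) - c * P (i, a) (l, ~~ (a (+) b)) +
         (P (j, b) (i, a) - c * P (i, a) (j, b))) = 0.
  by have := Tj a b; rewrite cw_next_succ.
have {}Tl a b : P (i, a) (j, a (+) b) - P (i, a) (l, b) +
    J * (P (j, a (+) b) (i, a) - c * P (i, a) (j, a (+) b) +
         (P (l, b) (i, a) - c * P (i, a) (l, b))) = 0.
  by have := Tl a b; rewrite cw_next_pred.
(* The clockwise cycle around (i, +) is (j, +), (l, -), (j, -), (l, +), and around (i, -) it is (j,
   +), (l, +), (j, -), (l, -). Opposite neighbours are two steps apart, so the modes of
   [cyclic_system] are sums and differences over the neighbour's sign. *)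
have [A1 A2 A3 A4] := cyclic_system J0 (Tj false false) (Tl false true) (Tj false true) (Tl false false).
have [B1 B2 B3 B4] := cyclic_system J0 (Tj true false) (Tl true false) (Tj true true) (Tl true true).
rewrite /= in A1 A2 A3 A4 B1 B2 B3 B4.
rewrite /parity_sum !expr0 !expr1.
split.
- transitivity (P (i, false) (j, false) + P (i, false) (j, true) +
    (-1) ^+ al * (P (i, true) (j, false) + P (i, true) (j, true))); first by ring.
  by rewrite A1 B1; ring.
- have A : P (j, false) (i, false) + P (j, true) (i, false) + P (l, false) (i, false) + P (l, true) (i, false)
      = c * (P (i, false) (j, false) + P (i, false) (j, true)) + c * (P (i, false) (l, true) + P (i, false) (l, false)).
    by apply/eqP; rewrite -subr_eq0 -[X in _ == X]A2; apply/eqP; ring.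
  have B : P (j, false) (i, true) + P (j, true) (i, true) + P (l, false) (i, true) + P (l, true) (i, true)
      = c * (P (i, true) (j, false) + P (i, true) (j, true)) + c * (P (i, true) (l, false) + P (i, true) (l, true)).
    by apply/eqP; rewrite -subr_eq0 -[X in _ == X]B2; apply/eqP; ring.
  rewrite -A1 in A; rewrite -B1 in B.
  transitivity ((P (j, false) (i, false) + P (j, true) (i, false) + P (l, false) (i, false) + P (l, true) (i, false)) +
     (-1) ^+ al * (P (j, false) (i, true) + P (j, true) (i, true) + P (l, false) (i, true) + P (l, true) (i, true))).
    by ring.
  by rewrite A B; ring.
- transitivity ((P (i, false) (l, false) - P (i, false) (l, true)) -
    (-1) ^+ al * (P (i, true) (l, true) - P (i, true) (l, false))); first by ring.
  by rewrite A3 B3; case: al => /=; rewrite ?expr0 ?expr1; ring.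
- transitivity ((P (i, false) (j, false) - P (i, false) (j, true)) +
    (-1) ^+ al * (P (i, true) (j, false) - P (i, true) (j, true))); first by ring.
  by rewrite A4 B4; case: al => /=; rewrite ?expr0 ?expr1; ring.
Qed.

(* For J = i k / sin k and c = cos k the two nonzero quantities are
   (1 - c) (1 + c + k^2 c) / (sin k)^2 and c + k^2 (1 + c). *)
Lemma axial_solution P c J : J != 0 ->
  1 - J ^+ 2 * (c * (1 - c)) != 0 ->
  c - J ^+ 2 * ((1 + c) * (1 - c ^+ 2)) != 0 ->
  (forall v w, oct_adj v w -> P v (cw_next v w) - P v w +
     J * ((P (cw_next v w) v - c * P v (cw_next v w)) + (P w v - c * P v w)) = 0) ->
  exists t : 'I_3 -> C, (forall v w, oct_adj v w -> P v w = t v.1) /\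
    forall i, t (ordS i) + t (ordS (ordS i)) = 2 * (c * t i).
Proof.
move=> J0 d1 d2 T.
have S := parity_system J0 T.
have block (i : 'I_3) : let j := ordS i in let l := ordS j in
    [/\ parity_sum P i j true true = 0, parity_sum P j i true true = 0,
       parity_sum P i l false true = 0, parity_sum P j l false true = 0
     & parity_sum P l i true false = 0 /\ parity_sum P l j true false = 0].
  move=> j l.
  have [_ _ p _] := S i false; have [_ _ _ x] := S i true.
  have [_ _ _ q] := S j false; have [_ _ y _] := S j true.
  have [a e _ _] := S l true.
  rewrite -/j -/l ordS3K -/j /= in p x q y a e.
  rewrite -a in y.
  by have [? ? ? ? al] := block_system d1 d2 p q x y e; split=> //; rewrite -a al.
(* Only the sums over all signs survive, and they do not depend on the axis of w; 4 is the constant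
   of Fourier inversion. *)
pose t i := parity_sum P i (ordS i) false false / 4.
have n4 : (4 : C) != 0 by rewrite pnatr_eq0.
exists t; split=> [[i a] [j b] ij|i].
  have [a00 _ _ _] := S i false.
  have [b1 _ b2 _ [b6 b7]] := block i.
  have [_ b3 _ b4 [b8 b9]] := block (ordS (ordS i)).
  have [_ _ _ _ [b10 b11]] := block (ordS i).
  rewrite !ordS3K in b3 b4 b8 b9 b10 b11.
  rewrite parity_sum_inv /t /=.
  case: (ord3_cases ij) => /= ->.
    by rewrite b1 b4 b10; field.
  by rewrite -a00 b2 b3 b11; field.
have [_ e _ _] := S i false; have [a00 _ _ _] := S (ordS i) false.
rewrite /t; rewrite ordS3K in a00 *.
by rewrite a00 -mulrDl e; ring.
Qed.

(** For sin k != 0 the flip of values can be solved for Q, which leaves a system in P alone. *)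
Lemma turn_of_boundary_data k P Q : k != 0 -> sin k != 0 -> boundary_data k P Q ->
  (forall v w, oct_adj v w -> Q v w = (k / sin k)%:C * (P w v - (cos k)%:C * P v w)) /\
  forall v w, oct_adj v w -> P v (cw_next v w) - P v w +
     'i%C * (k / sin k)%:C * ((P (cw_next v w) v - (cos k)%:C * P v (cw_next v w)) +
       (P w v - (cos k)%:C * P v w)) = 0.
Proof.
move=> k0 s0 [PE _ T].
have QE v w : oct_adj v w -> Q v w = (k / sin k)%:C * (P w v - (cos k)%:C * P v w).
  move=> vw; rewrite (PE v w vw).
  have e : (k / sin k)%:C * (sin k / k)%:C = 1 :> C.
    by rewrite -rmorphM mulrA divfK // divff // rmorph1.
  by rewrite -[LHS]mul1r -e; ring.
split=> // v w vw; rewrite -[RHS](T v w vw) !QE ?cw_next_adj //; ring.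
Qed.

Lemma neq0i : 'i%C != 0 :> C.
Proof. by rewrite eq_complex /= oner_eq0 andbF. Qed.

Lemma sqr_turn_factor k : ('i%C * (k / sin k)%:C) ^+ 2 = - (k ^+ 2 / sin k ^+ 2)%:C :> C.
Proof. by rewrite exprMn sqr_i mulN1r -rmorphXn exprMn exprVn. Qed.

Lemma axial_boundary_data k P Q : 0 < k -> sin k != 0 -> boundary_data k P Q ->
  1 + cos k + k ^+ 2 * cos k != 0 -> cos k + k ^+ 2 * (1 + cos k) != 0 ->
  exists t : 'I_3 -> C, (forall v w, oct_adj v w -> P v w = t v.1) /\
    forall i, t (ordS i) + t (ordS (ordS i)) = 2 * ((cos k)%:C * t i).
Proof.
move=> k0 s0 D d1 d2; have kn0 : k != 0 by rewrite gt_eqF.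
have [_ T] := turn_of_boundary_data kn0 s0 D.
have s2 : 1 - cos k ^+ 2 = sin k ^+ 2 by rewrite sin2cos2.
have s20 : sin k ^+ 2 != 0 by rewrite expf_neq0.
have c1 : 1 - cos k != 0.
  by apply: contraNneq s20 => /eqP; rewrite subr_eq0 => /eqP c1; rewrite -s2 -c1 expr1n subrr.
apply: axial_solution T.
- by rewrite mulf_neq0 ?neq0i // fmorph_eq0 mulf_neq0 ?invr_neq0.
- rewrite sqr_turn_factor (_ : _ - _ =
    (1 + k ^+ 2 / sin k ^+ 2 * (cos k * (1 - cos k)))%:C); last first.
    by rewrite !(rmorphD, rmorphM, rmorphB, rmorph1) /=; ring.
  rewrite fmorph_eq0; have : (1 - cos k) * (1 + cos k + k ^+ 2 * cos k) / sin k ^+ 2 != 0.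
    by rewrite !mulf_neq0 ?invr_neq0.
  by congr (_ != 0); rewrite -s2; field; rewrite s2.
- rewrite sqr_turn_factor (_ : _ - _ =
    (cos k + k ^+ 2 / sin k ^+ 2 * ((1 + cos k) * (1 - cos k ^+ 2)))%:C); last first.
    by rewrite !(rmorphD, rmorphM, rmorphB, rmorphXn, rmorph1) /=; ring.
  rewrite fmorph_eq0; move: d2; congr (_ != 0); rewrite s2; field; exact: s0.
Qed.
End OctahedronSystem.

(** * From bases of boundary data to multiplicities *)

Section Multiplicity.
Variable R : realType.
Notation C := R[i].
Local Notation "x %:C" := (real_complex R x) : ring_scope.
Implicit Types (P Q : octV -> octV -> C) (k x : R).
Variables (ends : octE -> bool -> octV) (star : octV -> 'I_4 -> octE * bool).
Hypotheses (Hends : oct_param ends) (Hstar : clockwise_numbering ends star).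
Notation U := (fun=> cyclic_mx R 4).

Lemma edge_functions_vanish k P Q : 0 < k ->
  (forall v w, oct_adj v w -> P w v = P v w * (cos k)%:C + Q v w * (sin k / k)%:C) ->
  (forall v w, oct_adj v w -> Q w v = P v w * (k * sin k)%:C - Q v w * (cos k)%:C) ->
  vanishes (edge_functions ends k P Q) ->
  forall v w, oct_adj v w -> P v w = 0 /\ Q v w = 0.
Proof.
move=> k0 PE QE van v w vw.
have kC0 : k%:C != 0 :> C by rewrite fmorph_eq0 gt_eqF.
have zero e : P (ends e false) (ends e true) = 0 /\ Q (ends e false) (ends e true) = 0.
  have [-> Qk] := cosc_ae0 k0 (van e); split=> //.
  by move/eqP: Qk; rewrite mulf_eq0 invr_eq0 (negPf kC0) orbF => /eqP.
have [[e b] <- <-] := dart_exists Hends vw.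
have adj := dart_adj Hends (e, false).
have [zP zQ] := zero e; rewrite /dart_tail /dart_head /= in adj *.
by case: b => //=; rewrite (PE _ _ adj) (QE _ _ adj) zP zQ !mul0r add0r subr0.
Qed.

Lemma eigenvalue_boundary_data k : 0 < k -> is_eigenvalue star U (k ^+ 2)%:C ->
  exists P Q, boundary_data k P Q /\
    ~ forall v w, oct_adj v w -> P v w = 0 /\ Q v w = 0.
Proof.
move=> k0 [f [/(eigen_edge_functions Hends Hstar (lt0r_neq0 k0))[P [Q [D fE]]] nv]].
exists P, Q; split=> // PQ0; apply: nv => e; apply: aeW => x x01.
rewrite fE; last by move: x01; rewrite in_itv /= => /andP[/ltW-> /ltW->].
have [] := PQ0 _ _ (dart_adj Hends (e, false)); rewrite /dart_tail /dart_head /= => p0 q0.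
by rewrite /edge_functions p0 q0 /cosc !mul0r addr0.
Qed.

(** Boundary data depend linearly and faithfully on the eigenfunction, so a basis is carried over.
    The size [n.+1] supplies a basis element as witness of the eigenvalue. *)
Lemma multiplicity_of_basis k n (P Q : 'I_n.+1 -> octV -> octV -> C) : 0 < k ->
  (forall j, boundary_data k (P j) (Q j)) ->
  (forall c : 'I_n.+1 -> C,
     (forall v w, oct_adj v w ->
        \sum_j c j * P j v w = 0 /\ \sum_j c j * Q j v w = 0) ->
     forall j, c j = 0) ->
  (forall P' Q', boundary_data k P' Q' -> exists c : 'I_n.+1 -> C,
     forall v w, oct_adj v w ->
       P' v w = \sum_j c j * P j v w /\ Q' v w = \sum_j c j * Q j v w) ->
  is_eigenvalue star U (k ^+ 2)%:C /\ has_multiplicity star U (k ^+ 2)%:C n.+1.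
Proof.
move=> k0 D indep span.
have kn0 := lt0r_neq0 k0.
have sumE (c : 'I_n.+1 -> C) e x :
    \sum_j c j * edge_functions ends k (P j) (Q j) e x =
    edge_functions ends k (fun v w => \sum_j c j * P j v w)
      (fun v w => \sum_j c j * Q j v w) e x.
  rewrite /edge_functions /cosc !mulr_suml -big_split /=; apply: eq_bigr => j _; ring.
have free (c : 'I_n.+1 -> C) :
    vanishes (fun e x => \sum_j c j * edge_functions ends k (P j) (Q j) e x) ->
    forall j, c j = 0.
  move=> van; apply: indep; apply: (@edge_functions_vanish k) => //.
  - move=> v w vw; rewrite !mulr_suml -big_split /=; apply: eq_bigr => j _.
    by rewrite (value_flip (D j) vw); ring.
  - move=> v w vw; rewrite !mulr_suml -sumrB; apply: eq_bigr => j _.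
    by rewrite (derivative_flip (D j) vw); ring.
  - by move=> e; apply: ae_lebesgue_mono (van e) => x; rewrite sumE.
have eig j := edge_functions_eigen Hends Hstar kn0 (D j).
split.
  exists (edge_functions ends k (P ord0) (Q ord0)); split=> // van.
  (* If the first basis function vanished, the coefficients (1, 0, ..., 0) would contradict
     independence. *)
  have /(_ ord0)/eqP : forall j : 'I_n.+1, (j == ord0)%:R = 0 :> C.
    apply: free => e; apply: ae_lebesgue_mono (van e) => x + x01 => /(_ x01) h.
    rewrite -[RHS]h (bigD1 ord0) //= mul1r big1 ?addr0 // => j /negPf->.
    by rewrite mul0r.
  by rewrite eqxx oner_eq0.
exists (fun j => edge_functions ends k (P j) (Q j)); split=> // f.
move=> /(eigen_edge_functions Hends Hstar kn0)[P' [Q' [/span[c cE] fE]]].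
exists c => e; apply: aeW => x x01.
rewrite fE; last by move: x01; rewrite in_itv /= => /andP[/ltW-> /ltW->].
have [pe qe] := cE _ _ (dart_adj Hends (e, false)).
rewrite /dart_tail /dart_head /= in pe qe.
by rewrite sumE /edge_functions pe qe subrr.
Qed.

End Multiplicity.

(** * The eigenvalues k = 2 pi n *)

(* The clockwise successor of v around w completes v, w to a face; a face is
   encoded by the signs of its vertices on the three axes. *)
Definition face (v w : octV) : {ffun 'I_3 -> bool} :=
  [ffun l => if l == v.1 then v.2 else if l == w.1 then w.2 else (cw_next w v).2].

(** A marked dart on each face, starting on the first axis; the parity of the three signs decides
    which of the two darts from there to another vertex of F has F as its [face]. *)
Definition face_dart (F : {ffun 'I_3 -> bool}) : octV * octV :=
  let i : 'I_3 := ord0 in let j := ordS i in let l := ordS j in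
  ((i, F i), if F i (+) F j (+) F l then (l, F l) else (j, F j)).

Lemma face_dart_adj F : oct_adj (face_dart F).1 (face_dart F).2.
Proof. by rewrite /face_dart; case: ifP. Qed.

Lemma face_dartK F : face (face_dart F).1 (face_dart F).2 = F.
Proof.
apply/ffunP => x; rewrite ffunE /face_dart /cw_next.
have /or3P[] : [|| x == ord0, x == ordS ord0 | x == ordS (ordS ord0)].
  by case: x => [[|[|[|?]]] ?].
all: move=> /eqP->; case E: (_ (+) _) => //=; move: E;
  by case: (F ord0); case: (F (ordS ord0)); case: (F (ordS (ordS ord0))).
Qed.

(** A cyclic shift preserves the orientation of a frame: with u = [cw_next v w], both (v, w, u) and
    (u, v, w) are negatively oriented. *)
Lemma cw_next_next v w : oct_adj v w -> cw_next (cw_next v w) v = w.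
Proof.
case: v w => [i a] [j b]; rewrite /oct_adj /= => /ord3_cases[] ->.
  by rewrite cw_next_succ /cw_next /= ordS3K eqxx; case: a b => -[].
by rewrite cw_next_pred -{2}(ordS3K i) cw_next_pred; case: a b => -[].
Qed.

(* Hence the map (w, v) -> (v, cw_next v w) walks around a face. *)
Lemma face_turn v w : oct_adj v w -> face v (cw_next v w) = face w v.
Proof.
move=> vw; apply/ffunP => l; rewrite !ffunE cw_next_next //.
case: v w vw => [i a] [j b]; rewrite /oct_adj /= => /ord3_cases ij.
have n1 (x : 'I_3) : (x == ordS x) = false := negPf (ordS3_neq x).
have n2 (x : 'I_3) : (x == ordS (ordS x)) = false := negPf (ordS3_neq2 x).
have m1 (x : 'I_3) : (ordS x == x) = false by rewrite eq_sym.
have m2 (x : 'I_3) : (ordS (ordS x) == x) = false by rewrite eq_sym.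
have ne := (n1, n2, m1, m2, eqxx).
have il : [\/ l = i, l = ordS i | l = ordS (ordS i)].
  case: (eqVneq i l) => [->|/ord3_cases[]->]; [exact: Or31|exact: Or32|exact: Or33].
by case: ij => ->; rewrite ?cw_next_succ ?cw_next_pred /=; case: il => ->; rewrite ?ne.
Qed.

(** The walk around a face has three darts, and one of them is the marked one. *)
Lemma face_dart_orbit v w : oct_adj v w ->
  [|| face_dart (face v w) == (v, w), face_dart (face v w) == (w, cw_next w v) |
      face_dart (face v w) == (cw_next w v, v)].
Proof.
rewrite /face_dart /face !ffunE /cw_next.
by case: v w => [[[|[|[|?]]] ?] []] [[[|[|[|?]]] ?] []].
Qed.

Section Faces.
Variable R : realType.
Notation C := R[i].
Local Notation "x %:C" := (real_complex R x) : ring_scope.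
Implicit Types (P Q X : octV -> octV -> C) (k : R).

(** X is constant along the walk around a face, which passes through the marked dart. *)
Lemma face_function X : (forall v w, oct_adj v w -> X v (cw_next v w) = X w v) ->
  forall v w, oct_adj v w ->
    X v w = X (face_dart (face v w)).1 (face_dart (face v w)).2.
Proof.
move=> XE v w vw; have wv : oct_adj w v by rewrite oct_adj_sym.
have /or3P[] := face_dart_orbit vw => /eqP-> //=; first by rewrite XE.
have uw : oct_adj (cw_next w v) w by rewrite oct_adj_sym cw_next_adj.
by have := XE _ _ uw; rewrite (cw_next_next wv) => ->; rewrite XE.
Qed.

(** Together with [antisym_part] this inverts X = P + i Q for symmetric P and antisymmetric Q. *)
Definition sym_part X v w : C := (X v w + X w v) / 2.
Definition antisym_part X v w : C := (X v w - X w v) / (2 * 'i%C).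

Lemma face_boundary_data k X : sin k = 0 -> cos k = 1 ->
  (forall v w, oct_adj v w -> X v (cw_next v w) = X w v) ->
  boundary_data k (sym_part X) (antisym_part X).
Proof.
move=> s0 c1 XE; have n2 : (2 : C) != 0 by rewrite pnatr_eq0.
have i0 := @neq0i R.
split=> v w vw; rewrite /sym_part /antisym_part ?s0 ?c1 ?mul0r ?mulr0 ?rmorph0 ?rmorph1.
- by field; rewrite ?i0 ?n2.
- by field; rewrite ?i0 ?n2.
- by rewrite XE //; field; rewrite ?i0 ?n2.
Qed.

(** With P symmetric and Q antisymmetric, P v w - i Q v w equals X w v, and the coupling condition
    collapses to one difference of values of X. *)
Lemma boundary_data_face k P Q : sin k = 0 -> cos k = 1 -> boundary_data k P Q ->
  let X v w := P v w + 'i%C * Q v w in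
  [/\ forall v w, oct_adj v w -> X v (cw_next v w) = X w v,
      forall v w, oct_adj v w -> P v w = sym_part X v w
    & forall v w, oct_adj v w -> Q v w = antisym_part X v w].
Proof.
move=> s0 c1 [PE QE T] X; have n2 : (2 : C) != 0 by rewrite pnatr_eq0.
have i0 := @neq0i R.
have {}PE v w : oct_adj v w -> P w v = P v w.
  by move=> /PE->; rewrite s0 c1 mul0r rmorph0 rmorph1 mulr0 mulr1 addr0.
have {}QE v w : oct_adj v w -> Q w v = - Q v w.
  by move=> /QE->; rewrite s0 c1 mulr0 rmorph0 rmorph1 mulr0 mulr1 sub0r.
split=> v w vw.
- apply/eqP; rewrite -subr_eq0 -[X in _ == X](T v w vw); apply/eqP.
  by rewrite /X (PE v w vw) (QE v w vw); ring.
- by rewrite /sym_part /X (PE v w vw) (QE v w vw); field.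
- by rewrite /antisym_part /X (PE v w vw) (QE v w vw); field; rewrite ?i0 ?n2.
Qed.

Variables (ends : octE -> bool -> octV) (star : octV -> 'I_4 -> octE * bool).
Hypotheses (Hends : oct_param ends) (Hstar : clockwise_numbering ends star).

Lemma face_multiplicity k : 0 < k -> sin k = 0 -> cos k = 1 ->
  is_eigenvalue star (fun=> cyclic_mx R 4) (k ^+ 2)%:C /\
  has_multiplicity star (fun=> cyclic_mx R 4) (k ^+ 2)%:C 8.
Proof.
move=> k0 s0 c1; have n2 : (2 : C) != 0 by rewrite pnatr_eq0.
have i0 := @neq0i R.
have F8 : #|{ffun 'I_3 -> bool}| = 8%N by rewrite card_ffun card_bool card_ord.
pose faceOf (j : 'I_8) : {ffun 'I_3 -> bool} := enum_val (cast_ord (esym F8) j).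
pose rank F : 'I_8 := cast_ord F8 (enum_rank F).
have faceOfK : cancel faceOf rank.
  by move=> j; rewrite /rank /faceOf enum_valK cast_ordKV.
have rankK : cancel rank faceOf.
  by move=> F; rewrite /rank /faceOf cast_ordK enum_rankK.
(* The basis consists of the indicator functions of the eight faces. *)
pose X j v w : C := (face v w == faceOf j)%:R.
have XE j v w : oct_adj v w -> X j v (cw_next v w) = X j w v.
  by move=> vw; rewrite /X face_turn.
have sumX (c : 'I_8 -> C) v w : \sum_j c j * X j v w = c (rank (face v w)).
  rewrite (bigD1 (rank (face v w))) //= /X rankK eqxx mulr1 big1 ?addr0 // => j jr.
  rewrite (_ : _ == _ = false) ?mulr0 //; apply: contra_neqF jr => /eqP->.
  by rewrite faceOfK.
have sumP (c : 'I_8 -> C) v w : \sum_j c j * sym_part (X j) v w =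
    (c (rank (face v w)) + c (rank (face w v))) / 2.
  by rewrite -(sumX c v w) -(sumX c w v) -big_split /= mulr_suml; apply: eq_bigr => j _; rewrite /sym_part; field.
have sumQ (c : 'I_8 -> C) v w : \sum_j c j * antisym_part (X j) v w =
    (c (rank (face v w)) - c (rank (face w v))) / (2 * 'i%C).
  rewrite -(sumX c v w) -(sumX c w v) -sumrB mulr_suml; apply: eq_bigr => j _; rewrite /antisym_part; field.
  by rewrite ?i0 ?n2.
apply: (multiplicity_of_basis Hends Hstar (P := fun j => sym_part (X j))
  (Q := fun j => antisym_part (X j))) => //.
- by move=> j; apply: face_boundary_data => //; exact: XE.
- move=> c cPQ j; have := face_dartK (faceOf j).
  have := face_dart_adj (faceOf j); case: face_dart => v w /= vw fE.
  have [] := cPQ v w vw; rewrite sumP sumQ fE faceOfK => p0 q0.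
  (* Adding i times the second relation to the first isolates the coefficient of the face of (v,
     w). *)
  rewrite -[RHS](addr0 0) -[X in _ = X + _]p0 -[X in _ = _ + X](mulr0 'i%C) -[X in _ = _ + _ * X]q0.
  by field; rewrite ?i0 ?n2.
- move=> P Q /(boundary_data_face s0 c1)[]; set Y := fun v w => _ => YE PE QE.
  exists (fun j => Y (face_dart (faceOf j)).1 (face_dart (faceOf j)).2) => v w vw.
  have wv : oct_adj w v by rewrite oct_adj_sym.
  rewrite sumP sumQ !rankK -!face_function //.
  by rewrite (PE v w vw) (QE v w vw).
Qed.

End Faces.

(** * Trigonometric estimates *)

Section Trig.
Variable R : realType.
Implicit Types (x y k : R) (n : int).

Lemma sin_cosD2pi_int x n :
  sin (x + 2 * pi * n%:~R) = sin x /\ cos (x + 2 * pi * n%:~R) = cos x.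
Proof.
have E (m : nat) : 2 * pi * m%:R = (pi *+ 2) *+ m :> R by rewrite mulr_natr mulr_natl.
have P (m : nat) y : sin (y + 2 * pi * m%:R) = sin y /\ cos (y + 2 * pi * m%:R) = cos y.
  by rewrite E; split; [exact: periodicn (@sinD2pi R) _ _|exact: periodicn (@cosD2pi R) _ _].
case: n => m; first exact: P.
have [s c] := P m.+1 (x + 2 * pi * (Negz m)%:~R).
by rewrite -s -c NegzE mulrNz mulrN subrK.
Qed.

Lemma mod2pi x : exists n y, x = y + 2 * pi * n%:~R /\ `|y| <= pi.
Proof.
have p0 := pi_gt0 R.
pose n := Num.floor ((x + pi) / (2 * pi)).
exists n, (x - 2 * pi * n%:~R); split; first by rewrite subrK.
have p2 : 0 < 2 * pi :> R by rewrite mulr_gt0.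
have : n%:~R <= (x + pi) / (2 * pi) by exact: floor_le.
have : (x + pi) / (2 * pi) < (n + 1)%:~R by exact: floorD1_gt.
rewrite ltr_pdivrMr // ler_pdivlMr // intrD => h1 h2.
by rewrite ler_norml; apply/andP; split; lra.
Qed.

Lemma le_2sin y : 0 <= y <= pi / 2 -> y <= 2 * sin y.
Proof.
move=> /andP[]; rewrite le_eqVlt => /orP[/eqP<-|y0]; first by rewrite sin0 mulr0.
rewrite le_eqVlt => /orP[/eqP->|yp].
  by rewrite sin_pihalf mulr1 ltW // pihalf_lt2.
rewrite leNgt; apply/negP => ylt.
(* 2 sin z - z is nonnegative at 0 and pi / 2; were it negative at y, its
   decreasing derivative would be negative before y and positive after. *)
have d x : is_derive x 1 (fun z => 2 * sin z - z) (2 * cos x - 1).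
  by apply: is_derive_eq; rewrite /GRing.scale /=; ring.
have c : continuous (fun z : R => 2 * sin z - z).
  by move=> x; apply/differentiable_continuous/derivable1_diffP/(@ex_derive _ _ _ _ _ _ _ (d x)).
have [a] := MVT y0 (fun x _ => d x) (continuous_subspaceT c).
rewrite in_itv /= => /andP[a0 ay]; rewrite sin0 => ea.
have [b] := MVT yp (fun x _ => d x) (continuous_subspaceT c).
rewrite in_itv /= => /andP[yb bp]; rewrite sin_pihalf => eb.
have p2 := pihalf_lt2 R; have p0 := pi_gt0 R.
have : cos b < cos a.
  by rewrite ltr_cos ?in_itv /= ?(lt_trans ay) //; apply/andP; split; lra.
have : 2 * cos a - 1 < 0.
  by rewrite -(pmulr_llt0 _ (_ : 0 < y - 0)) ?subr_gt0 // -ea; lra.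
have : 0 < 2 * cos b - 1.
  by rewrite -(pmulr_lgt0 _ (_ : 0 < pi / 2 - y)) ?subr_gt0 // -eb; lra.
lra.
Qed.

(** From 1 - cos x = 2 sin^2 (x/2) and y <= 2 sin y at y = x/2. *)
Lemma le_sqr_versine x : 0 <= x <= pi -> x ^+ 2 <= 8 * (1 - cos x).
Proof.
move=> /andP[x0 xp].
have h : x / 2 <= 2 * sin (x / 2).
  by apply: le_2sin; apply/andP; split; lra.
have -> : cos x = 1 - 2 * sin (x / 2) ^+ 2.
  rewrite {1}(_ : x = (x / 2) *+ 2); last by rewrite -mulr_natr divfK.
  by rewrite cos_mulr2n cos2sin2; ring.
have : (x / 2) ^+ 2 <= (2 * sin (x / 2)) ^+ 2.
  by rewrite lerXn2r ?nnegrE //; lra.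
rewrite !exprMn; lra.
Qed.

(** The triple angle formula makes the cosine c a root of 4 c^3 - 3 c - 1 = (c - 1) (2 c + 1)^2, and
    c = 1 is excluded by the positive sine. *)
Lemma cos_2pi3 : cos (2 / 3 * pi) = - 1 / 2 :> R.
Proof.
have p0 := pi_gt0 R.
set x := 2 / 3 * pi.
have s0 : 0 < sin x by apply: sin_gt0_pi; apply/andP; split; rewrite /x; lra.
have c3 : 4 * cos x ^+ 3 - 3 * cos x = 1.
  have x3 : x *+ 2 + x = pi *+ 2 by rewrite -(mulr_natr x) -(mulr_natr pi) /x; field.
  have := cos2pi R; rewrite -x3 cosD cos_mulr2n sin_mulr2n => e; rewrite -[RHS]e {e}.
  have := sin2cos2 x; move: (sin x) (cos x) => s c h.
  rewrite [X in _ = _ - X](_ : _ = 2 * c * s ^+ 2); last by ring.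
  by rewrite h; ring.
have : (cos x - 1) * (2 * cos x + 1) ^+ 2 = 0.
  rewrite [LHS](_ : _ = 4 * cos x ^+ 3 - 3 * cos x - 1); last by ring.
  by rewrite c3 subrr.
move/eqP; rewrite mulf_eq0 sqrf_eq0 => /orP[/eqP h|/eqP h]; last lra.
have := sin2cos2 x; rewrite (_ : cos x = 1) ?expr1n ?subrr; last lra.
by move/eqP; rewrite sqrf_eq0 gt_eqF.
Qed.

Lemma cos_eq_mod2pi k x : 0 <= x <= pi -> cos k = cos x ->
  exists n, k = x + 2 * pi * n%:~R \/ k = - x + 2 * pi * n%:~R.
Proof.
move=> x0p; have [n [y [-> yp]]] := mod2pi k.
rewrite (sin_cosD2pi_int y n).2 -cos_norm => e; exists n.
have <- : `|y| = x by apply: cos_inj e => //; rewrite in_itv /= normr_ge0.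
by case: (ger0P y) => y0; [left|right; rewrite opprK].
Qed.

End Trig.

(** * Multiplicities and localization *)

Section AxialMultiplicity.
Variable R : realType.
Notation C := R[i].
Local Notation "x %:C" := (real_complex R x) : ring_scope.
Implicit Types (P Q : octV -> octV -> C) (k : R) (t : 'I_3 -> C).

(** P is constant around each vertex, so the coupling asks that consecutive Q cancel: t w' + t w - 2
    cos k t v = 0. For cos k = -1/2 this is the vanishing of the sum of t over the three axes. *)
Lemma axial_value_boundary_data k t : 0 < k -> sin k != 0 -> cos k = - 1 / 2 ->
  (forall i, t i + t (ordS i) + t (ordS (ordS i)) = 0) ->
  boundary_data k (fun v _ => t v.1)
    (fun v w => (k / sin k)%:C * (t w.1 - (cos k)%:C * t v.1)).
Proof.
move=> k0 s0 c2 sum0.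
have kC0 : k%:C != 0 :> C by rewrite fmorph_eq0 gt_eqF.
have sC0 : (sin k)%:C != 0 :> C by rewrite fmorph_eq0.
have s2 : (sin k)%:C ^+ 2 = 1 - (cos k)%:C ^+ 2 :> C.
  by rewrite -!rmorphXn sin2cos2 rmorphB rmorph1.
have c2C : (cos k)%:C = - 1 / 2 :> C by rewrite c2 fmorph_div rmorphN rmorph1 rmorph_nat.
split=> v w vw; rewrite ?fmorph_div ?rmorphM /=.
- by field; rewrite kC0.
- apply: (mulfI sC0); rewrite [RHS](_ : _ = k%:C * ((sin k)%:C ^+ 2 * t v.1)
    - k%:C * (t w.1 - (cos k)%:C * t v.1) * (cos k)%:C); last by field.
  by rewrite s2; field.
- have e : t (cw_next v w).1 + t w.1 + t v.1 = 0.
    case: v w vw => [i a] [j b]; rewrite /oct_adj /= => /ord3_cases[] ->.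
      by rewrite cw_next_succ /= -[RHS](sum0 i); ring.
    by rewrite cw_next_pred /= -[RHS](sum0 i); ring.
  by rewrite subrr add0r c2C -[RHS](mulr0 ('i%C * (k%:C / (sin k)%:C))) -[X in _ = _ * X]e; field.
Qed.

Variables (ends : octE -> bool -> octV) (star : octV -> 'I_4 -> octE * bool).
Hypotheses (Hends : oct_param ends) (Hstar : clockwise_numbering ends star).

(** The eigenspace is the plane of axis functions with zero sum. The two secular factors equal (1 -
    k^2)/2 and (k^2 - 1)/2 here, so 1 < k keeps them nonzero. *)
Lemma axial_multiplicity k : 1 < k -> sin k != 0 -> cos k = - 1 / 2 ->
  is_eigenvalue star (fun=> cyclic_mx R 4) (k ^+ 2)%:C /\
  has_multiplicity star (fun=> cyclic_mx R 4) (k ^+ 2)%:C 2.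
Proof.
move=> k1 s0 c2; have k0 : 0 < k := lt_trans ltr01 k1.
have kn0 := lt0r_neq0 k0.
(* The basis e_0 - e_2, e_1 - e_2 of the plane; the coordinates of t are its first two entries. *)
pose T (j : 'I_2) (i : 'I_3) : C :=
  (i == widen_ord (leqnSn 2) j)%:R - (i == ord_max)%:R.
have TE (c : 'I_2 -> C) i : \sum_j c j * T j i =
    if i == 0 :> nat then c ord0 else if i == 1%N :> nat then c ord_max
    else - c ord0 - c ord_max.
  rewrite !big_ord_recl big_ord0 addr0 (_ : lift ord0 ord0 = ord_max); last exact: val_inj.
  by case: i => [[|[|[|?]]] ?] //; rewrite /T -!val_eqE /=; ring.
have T0 j i : T j i + T j (ordS i) + T j (ordS (ordS i)) = 0.
  by case: i j => [[|[|[|?]]] ?] [[|[|?]] ?] //; rewrite /T -!val_eqE /=; ring.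
have linear (c : 'I_2 -> C) (d e : C) i j :
    \sum_l c l * (d * (T l i - e * T l j)) =
    d * (\sum_l c l * T l i - e * \sum_l c l * T l j).
  rewrite !mulr_sumr -sumrB mulr_sumr; apply: eq_bigr => l _; ring.
apply: (multiplicity_of_basis Hends Hstar (P := fun j v _ => T j v.1)
  (Q := fun j v w => (k / sin k)%:C * (T j w.1 - (cos k)%:C * T j v.1))) => //.
- by move=> j; exact: axial_value_boundary_data.
- move=> c cPQ.
  have c0 (i : 'I_3) : \sum_j c j * T j i = 0.
    by have [] := cPQ (i, false) (ordS i, false) (ordS3_neq i).
  move=> j; have := c0 (widen_ord (leqnSn 2) j); rewrite TE.
  by case: j => [[|[|?]] p] //= <-; congr c; exact: val_inj.
- move=> P Q D.
  have [||t [Pt tE]] := axial_boundary_data k0 s0 D; [rewrite c2; nra..|].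
  have [QE _] := turn_of_boundary_data kn0 s0 D.
  have c2C : (cos k)%:C = - 1 / 2 :> C by rewrite c2 fmorph_div rmorphN rmorph1 rmorph_nat.
  exists (fun j => t (widen_ord (leqnSn 2) j)).
  have tT (i : 'I_3) : \sum_j t (widen_ord (leqnSn 2) j) * T j i = t i.
    have o (a b : 'I_3) : a = b :> nat -> t a = t b by move/val_inj->.
    rewrite TE; case: i => [[|[|[|?]]] p] //=; try exact: o.
    have := tE (Ordinal p); rewrite c2C => e.
    rewrite (o _ (ordS (Ordinal p))) // (o (widen_ord _ ord_max) (ordS (ordS (Ordinal p)))) //.
    by rewrite -opprD e; field.
  move=> v w vw; have wv : oct_adj w v by rewrite oct_adj_sym.
  by rewrite linear !tT QE // !Pt.
Qed.

(** If neither factor vanishes, P is given by an axis function t. Subtracting the relations of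
    consecutive axes gives (1 + 2 cos k)(t (i+1) - t i) = 0; so t is constant, and then 2 (1 - cos
    k) t = 0. *)
Lemma eigenvalue_secular k : 0 < k -> sin k != 0 -> cos k != - 1 / 2 ->
  is_eigenvalue star (fun=> cyclic_mx R 4) (k ^+ 2)%:C ->
  1 + cos k + k ^+ 2 * cos k = 0 \/ cos k + k ^+ 2 * (1 + cos k) = 0.
Proof.
move=> k0 s0 c2 /(eigenvalue_boundary_data Hends Hstar k0)[P [Q [D nz]]].
have [/eqP|d1] := eqVneq (1 + cos k + k ^+ 2 * cos k) 0; first by move/eqP; left.
have [/eqP|d2] := eqVneq (cos k + k ^+ 2 * (1 + cos k)) 0; first by move/eqP; right.
case: nz; have [t [Pt tE]] := axial_boundary_data k0 s0 D d1 d2.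
have [QE _] := turn_of_boundary_data (lt0r_neq0 k0) s0 D.
have c1 : 1 - (cos k)%:C != 0 :> C.
  rewrite -(rmorph1 (real_complex R)) -rmorphB fmorph_eq0.
  by apply: contraNneq s0 => /eqP; rewrite subr_eq0 -sqrf_eq0 sin2cos2 => /eqP<-; rewrite expr1n subrr.
have c3 : 1 + 2 * (cos k)%:C != 0 :> C.
  rewrite -(rmorph1 (real_complex R)) -(rmorph_nat (real_complex R) 2) -rmorphM -rmorphD fmorph_eq0.
  by apply: contraNneq c2 => h; apply/eqP; lra.
have n2 : (2 : C) != 0 by rewrite pnatr_eq0.
have succ i : t (ordS i) = t i.
  apply/eqP; rewrite -subr_eq0 -(mulrI_eq0 _ (mulfI c3)); apply/eqP.
  have := tE i; have := tE (ordS i); rewrite ordS3K => e1 e2.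
  transitivity ((t (ordS i) + t (ordS (ordS i)) - 2 * ((cos k)%:C * t i)) -
    (t (ordS (ordS i)) + t i - 2 * ((cos k)%:C * t (ordS i)))); first by ring.
  by rewrite e1 e2; ring.
have t0 i : t i = 0.
  apply: (mulfI c1); apply: (mulfI n2); rewrite !mulr0.
  by have := tE i; rewrite !succ => e; rewrite mulrBl mulrBr -e; ring.
move=> v w vw; have wv : oct_adj w v by rewrite oct_adj_sym.
by rewrite QE // !Pt // !t0; split=> //; ring.
Qed.

End AxialMultiplicity.

(** * Localization of the remaining eigenvalues *)

Section Localization.
Variable R : realType.
Implicit Types (k : R) (n : int).

(** With d the distance from |y| to pi, d^2 k^2 <= 8 (1 + cos k) k^2 = - 8 cos k <= 8, which is
    below 10. *)
Lemma near_pi k : 0 < k -> cos k + k ^+ 2 * (1 + cos k) = 0 ->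
  exists n, `|k - pi - 2 * pi * n%:~R| <= Num.sqrt 10 / k.
Proof.
move=> k0 sec; have [n [y [kE yp]]] := mod2pi k.
have cE : cos `|y| = cos k by rewrite cos_norm kE (sin_cosD2pi_int y n).2.
have d0 : 0 <= pi - `|y| <= pi by rewrite subr_ge0 yp gerBl normr_ge0.
have k20 : 0 < k ^+ 2 by rewrite exprn_gt0.
have bound : pi - `|y| <= Num.sqrt 10 / k.
  have /andP[d1 _] := d0.
  rewrite -(ler_pXn2r (n := 2)) ?nnegrE ?divr_ge0 ?sqrtr_ge0 ?(ltW k0) //.
  rewrite expr_div_n sqr_sqrtr ?ler0n // ler_pdivlMr //.
  have := le_sqr_versine d0.
  rewrite cosB cospi sinpi cE mul0r addr0 mulN1r opprK => h.
  have : (pi - `|y|) ^+ 2 * k ^+ 2 <= 8 * (1 + cos k) * k ^+ 2 by rewrite ler_pM2r.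
  have := cos_geN1 k; nra.
case: (ger0P y) bound d0 => y0 bound /andP[d0 _].
  exists n; have -> : k - pi - 2 * pi * n%:~R = - (pi - y) by rewrite kE; ring.
  by rewrite normrN ger0_norm.
(* For negative y the nearby centre is - pi + 2 pi n = pi + 2 pi (n - 1). *)
exists (n - 1); have -> : k - pi - 2 * pi * (n - 1)%:~R = pi - - y.
  by rewrite kE intrB mulr1z; ring.
by rewrite ger0_norm.
Qed.

(** The distance from |y| to pi/2 is at most 2 |cos k|, and k^2 |cos k| = 1 + cos k <= 2; this gives
    4, below 5. *)
Lemma near_pihalf k : 0 < k -> 1 + cos k + k ^+ 2 * cos k = 0 ->
  exists n, `|k - pi / 2 - pi * n%:~R| <= 5 / k ^+ 2.
Proof.
move=> k0 sec; have [n [y [kE yp]]] := mod2pi k.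
have cE : cos `|y| = cos k by rewrite cos_norm kE (sin_cosD2pi_int y n).2.
have k20 : 0 < k ^+ 2 by rewrite exprn_gt0.
have bound : `|(`|y| - pi / 2)| <= 5 / k ^+ 2.
  have h : `|(`|y| - pi / 2)| <= 2 * `|cos k|.
    have p0 := pi_gt0 R; have y0 := normr_ge0 y.
    have [d0|d0] := ger0P (`|y| - pi / 2).
      have := @le_2sin R (`|y| - pi / 2); rewrite sinBpihalf cE => /(_ _)/le_trans; apply.
        by apply/andP; split; lra.
      by rewrite ler_pM2l // -normrN ler_norm.
    have := @le_2sin R (- (`|y| - pi / 2)); rewrite sinN sinBpihalf opprK cE => /(_ _)/le_trans; apply.
      by apply/andP; split; lra.
    by rewrite ler_pM2l // ler_norm.
  rewrite ler_pdivlMr //; apply: (le_trans (ler_wpM2r (ltW k20) h)).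
  have -> : 2 * `|cos k| * k ^+ 2 = 2 * (1 + cos k).
    rewrite -mulrA; congr (_ * _); rewrite -[X in _ * X = _](gtr0_norm k20) -normrM -normrN.
    rewrite (_ : - _ = 1 + cos k); last by rewrite -[RHS]subr0 -sec; ring.
    by rewrite ger0_norm // addrC -lerBlDr sub0r cos_geN1.
  have := cos_le1 k; lra.
case: (ger0P y) bound => y0 bound.
  exists (2 * n); have -> : k - pi / 2 - pi * (2 * n)%:~R = y - pi / 2.
    by rewrite kE intrM; ring.
  exact: bound.
(* For negative y the centre is - pi/2 + 2 pi n = pi/2 + pi (2 n - 1). *)
exists (2 * n - 1).
have -> : k - pi / 2 - pi * (2 * n - 1)%:~R = - (- y - pi / 2).
  by rewrite kE intrB intrM mulr1z; field.
by rewrite normrN.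
Qed.

Lemma sin_eq0_near_pi k : sin k = 0 -> cos k != 1 ->
  exists n, k = pi + 2 * pi * n%:~R.
Proof.
move=> s0 c1.
have cN : cos k = cos pi.
  have := sin2cos2 k; rewrite s0 expr0n /= cospi => /esym/eqP.
  by rewrite subr_eq0 eq_sym sqrf_eq1 (negPf c1) => /eqP.
have [|n [->|->]] := @cos_eq_mod2pi R k pi _ cN; first by rewrite pi_ge0 lexx.
  by exists n.
by exists (n - 1); rewrite intrB mulr1z; ring.
Qed.

End Localization.

Theorem theorem5p1 (R : realType)
    (ends : octE -> bool -> octV) (star : octV -> 'I_4 -> octE * bool)
    (Hends : oct_param ends) (Hstar : clockwise_numbering ends star) :
  let U : octV -> 'M[R[i]]_4 := fun=> cyclic_mx R 4 in
  let eigenvalue (lambda : R) := is_eigenvalue star U (real_complex R lambda) in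
  let multiplicity (lambda : R) (m : nat) :=
    has_multiplicity star U (real_complex R lambda) m in
  [/\ forall (n : int) (k : R), k = 2 * pi * n%:~R -> 0 < k ->
        eigenvalue (k ^+ 2) /\ multiplicity (k ^+ 2) 8%N,
      forall (n : int) (k : R),
        k = 2 / 3 * pi + 2 * pi * n%:~R \/ k = - (2 / 3 * pi) + 2 * pi * n%:~R ->
        0 < k ->
        eigenvalue (k ^+ 2) /\ multiplicity (k ^+ 2) 2%N
    & exists C K : R, [/\ 0 < C, 0 < K
      & forall k : R, K <= k -> eigenvalue (k ^+ 2) ->
          (forall n : int, [/\ k <> 2 * pi * n%:~R,
             k <> 2 / 3 * pi + 2 * pi * n%:~R
           & k <> - (2 / 3 * pi) + 2 * pi * n%:~R]) ->
          exists n : int,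
            `|k - pi - 2 * pi * n%:~R| <= Num.sqrt 10 / k + C / k ^+ 2 \/
            `|k - pi / 2 - pi * n%:~R| <= 5 / k ^+ 2 + C / k ^+ 4]].
Proof.
split.
- move=> n k kE k0; have [s c] := sin_cosD2pi_int (0 : R) n.
  rewrite add0r -kE sin0 in s; rewrite add0r -kE cos0 in c.
  exact: (face_multiplicity Hends Hstar k0 s c).
- move=> n k kE k0; have p0 := pi_ge2 R.
  have c3 := cos_2pi3 R.
  have s3 : sin (2 / 3 * pi) != 0 :> R.
    by rewrite gt_eqF // sin_gt0_pi //; apply/andP; split; lra.
  have [sk ck] : sin k != 0 /\ cos k = - 1 / 2.
    case: kE => ->.
      by have [-> ->] := @sin_cosD2pi_int R (2 / 3 * pi) n.
    by have [-> ->] := @sin_cosD2pi_int R (- (2 / 3 * pi)) n; rewrite sinN cosN oppr_eq0.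
  apply: (axial_multiplicity Hends Hstar _ sk ck).
  (* It remains to see that 1 < k: the smallest positive members of the two families are 2 pi/3 and
     4 pi/3. *)
  case: kE k0 => ->.
    case: (lerP 0 n) => [n0 _|n0].
      have : 0 <= 2 * pi * n%:~R :> R by rewrite mulr_ge0 ?mulr_ge0 ?pi_ge0 // ler0z.
      lra.
    have : (n + 1)%:~R <= 0 :> R by rewrite lerz0 lezD1.
    rewrite intrD mulr1z; nra.
  case: (lerP n 0) => [n0|n0 _].
    have : n%:~R <= 0 :> R by rewrite lerz0.
    nra.
  have : 1 <= n%:~R :> R by rewrite -[1](mulr1z 1) ler_int -gtz0_ge1.
  nra.
(* The localization bounds hold for every k > 0 without error terms, so any positive constants
   serve. *)
- exists 1, 1; split=> // k k1 ev special.
  have k0 : 0 < k := lt_le_trans ltr01 k1.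
  have e1 : 0 <= 1 / k ^+ 2 by rewrite divr_ge0 // exprn_ge0 // ltW.
  have e2 : 0 <= 1 / k ^+ 4 by rewrite divr_ge0 // exprn_ge0 // ltW.
  have c1 : cos k != 1.
    apply/eqP => c1.
    have [|n [] kE] := @cos_eq_mod2pi R k 0 _ (etrans c1 (esym (cos0 R))).
    - by rewrite lexx pi_ge0.
    - by have [] := special n; rewrite kE add0r.
    - by have [] := special n; rewrite kE oppr0 add0r.
  (* For sin k = 0 the elimination of Q fails, but k is then an odd multiple of pi, the exact centre
     of an interval of the first kind. *)
  have [s0|s0] := eqVneq (sin k) 0.
    have [n kE] := sin_eq0_near_pi s0 c1; exists n; left.
    rewrite {1}kE (addrC pi) addrK subrr normr0 addr_ge0 //.
    by rewrite divr_ge0 ?sqrtr_ge0 // ltW.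
  have c2 : cos k != - 1 / 2.
    apply/eqP => c2; have p0 := pi_ge0 R.
    have [|n [] kE] := @cos_eq_mod2pi R k (2 / 3 * pi) _ (etrans c2 (esym (cos_2pi3 R))).
    - by apply/andP; split; lra.
    - by have [] := special n.
    - by have [] := special n.
  have [/near_pihalf[//|n h]|/near_pi[//|n h]] := eigenvalue_secular Hends Hstar k0 s0 c2 ev.
    by exists n; right; apply: (le_trans h); rewrite lerDl.
  by exists n; left; apply: (le_trans h); rewrite lerDl.
Qed.
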